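(* Let $K,\gamma\in\mathbb{R}$, $\beta\in[0,\pi]$, and consider the delay equation $$\dot z(t)=(\lambda+i)z(t)+(1+i\gamma)|z(t)|^2z(t)-Ke^{i\beta}\left[z(t)-z(t-\tau)\right],\qquad z(t)\in\mathbb{C},$$ where all parameters but $\lambda$ are kept fixed. Let $(\lambda,\tau)\neq(0,0)$, $\tau\ge0$, be such that a Hopf bifurcation of the origin occurs, i.e. such that for some $\phi\in\mathbb{R}\setminus\{0\}$ $$\lambda=K[\cos\beta-\cos(\beta-\phi)],\qquad\tau=\frac{\phi}{1-K[\sin\beta-\sin(\beta-\phi)]},$$ $$1+K\tau e^{i(\beta-\phi)}\neq0,\qquad1+K\tau\cos(\beta-\phi)>0.$$ If $$1+K\tau\left[\cos(\beta-\phi)+\gamma\sin(\beta-\phi)\right]>0,$$ then the Hopf bifurcation at $(\lambda,\tau)$ is subcritical. If $$1+K\tau\left[\cos(\beta-\phi)+\gamma\sin(\beta-\phi)\right]<0,$$ then the Hopf bifurcation at $(\lambda,\tau)$ is supercritical.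
   Context: Under the stated conditions $\mu=i\omega_0$ with $\omega_0=\phi/\tau$ is a root of the characteristic equation $\mu-(\lambda+i)+Ke^{i\beta}(1-e^{-\mu\tau})=0$ of the linearization at $z=0$, and it crosses from the left to the right half plane with non-zero speed as $\lambda$ increases. At a Hopf bifurcation a branch of small-amplitude periodic solutions with period near $2\pi/|\omega_0|$ bifurcates from the origin. The Hopf bifurcation is subcritical if these periodic solutions exist for nearby parameter values $\lambda$ for which the critical root lies in the left half plane (i.e. to the left of the bifurcation value), and supercritical if they exist for nearby values for which the critical root lies in the right half plane (i.e. to the right of the bifurcation value). *)

(* Defs.v *)
From Stdlib Require Import Reals.
From Coquelicot Require Import Coquelicot.
Open Scope R_scope.

Definition Cexp (w : C) : C :=
  (RtoC (exp (Re w)) * (cos (Im w), sin (Im w)))%C.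

Definition dde_solution (K gamma beta tau lam : R) (z : R -> C) : Prop :=
  forall t : R,
    is_derive (K := R_AbsRing) (V := C_R_NormedModule) z t
      ((RtoC lam + Ci) * z t
       + (RtoC 1 + Ci * RtoC gamma) * RtoC (Cmod (z t) ^ 2) * z t
       - RtoC K * Cexp (Ci * RtoC beta) * (z t - z (t - tau)%R))%C.

Definition periodic_solution (K gamma beta tau lam T : R) (z : R -> C) : Prop :=
  dde_solution K gamma beta tau lam z /\
  0 < T /\ (forall t : R, z (t + T) = z t) /\
  (exists t : R, z t <> z 0).

Definition char_fun (K beta tau lam : R) (mu : C) : C :=
  (mu - (RtoC lam + Ci)
   + RtoC K * Cexp (Ci * RtoC beta)
     * (RtoC 1 - Cexp (- (mu * RtoC tau))))%C.

(* The continuation in lam of the root i w0 of the characteristic equation at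
   lam0.  As a germ at lam0 it is unique whenever the root is simple. *)
Definition critical_root (K beta tau lam0 w0 : R) (mu : R -> C) : Prop :=
  mu lam0 = (Ci * RtoC w0)%C /\
  exists delta : R, 0 < delta /\
    forall lam : R, Rabs (lam - lam0) < delta ->
      char_fun K beta tau lam (mu lam) = RtoC 0 /\ continuous mu lam.

(* z is a periodic solution of small amplitude, of period T near 2 pi / |w0|,
   at a parameter lam near lam0, and it is to leading order (relative to its
   amplitude) the solution a e^{i w0 t} of the linearization.  The last
   condition selects the solutions that bifurcate through the critical root
   i w0: nothing excludes a second root i k w0 at lam0, which would have
   periodic solutions of its own. *)
Definition near_bifurcation (K gamma beta tau lam0 w0 eta lam T : R)
    (z : R -> C) : Prop :=
  periodic_solution K gamma beta tau lam T z /\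
  Rabs (lam - lam0) < eta /\
  Rabs (T - 2 * PI / Rabs w0) < eta /\
  exists a : C, a <> RtoC 0 /\ Cmod a < eta /\
    forall t : R, 0 <= t <= T ->
      Cmod (z t - a * Cexp (Ci * RtoC (w0 * t)))%C <= eta * Cmod a.

(* A continuous one-parameter family of periodic solutions that shrinks to the
   origin at (lam0, 2 pi / |w0|) as its parameter eps tends to 0+. *)
Definition bifurcating_branch (K gamma beta tau lam0 w0 eps0 : R)
    (lam T : R -> R) (z : R -> R -> C) : Prop :=
  0 < eps0 /\
  (forall eps : R, 0 < eps < eps0 ->
    periodic_solution K gamma beta tau (lam eps) (T eps) (z eps) /\
    continuous lam eps /\ continuous T eps /\
    (forall t : R, continuous (fun p : R * R => z (fst p) (snd p)) (eps, t))) /\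
  (forall eta : R, 0 < eta ->
    exists delta : R, 0 < delta <= eps0 /\
      forall eps : R, 0 < eps < delta ->
        near_bifurcation K gamma beta tau lam0 w0 eta
          (lam eps) (T eps) (z eps)).

(* Since lam is continuous along the branch and tends to lam0, existence of the
   branch together with the sign condition gives, by the intermediate value
   theorem, periodic solutions for every lam close enough to lam0 on the
   indicated side. *)
Definition subcritical_hopf (K gamma beta tau lam0 w0 : R) : Prop :=
  (exists (eps0 : R) (lam T : R -> R) (z : R -> R -> C),
    bifurcating_branch K gamma beta tau lam0 w0 eps0 lam T z) /\
  exists mu : R -> C,
    critical_root K beta tau lam0 w0 mu /\
    exists eta : R, 0 < eta /\
      forall (lam T : R) (z : R -> C),
        near_bifurcation K gamma beta tau lam0 w0 eta lam T z ->
        Re (mu lam) < 0 /\ lam < lam0.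

Definition supercritical_hopf (K gamma beta tau lam0 w0 : R) : Prop :=
  (exists (eps0 : R) (lam T : R -> R) (z : R -> R -> C),
    bifurcating_branch K gamma beta tau lam0 w0 eps0 lam T z) /\
  exists mu : R -> C,
    critical_root K beta tau lam0 w0 mu /\
    exists eta : R, 0 < eta /\
      forall (lam T : R) (z : R -> C),
        near_bifurcation K gamma beta tau lam0 w0 eta lam T z ->
        0 < Re (mu lam) /\ lam0 < lam.

(* Main.v *)
Require Import Defs.
From Stdlib Require Import Reals Lra Lia Psatz.
From Coquelicot Require Import Coquelicot.
Open Scope R_scope.

(** Write [w0 = phi / tau], and for a real frequency [om] split the
    characteristic function at [i om] into its real part, which is
    [wave_lam om - lam], and its imaginary part [wave_detuning om]; both are
    [0] at [om = w0] and the given [lam], which is called [lam0] below.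
    Put [D = 1 + K tau cos (beta - phi)] and [S = K tau sin (beta - phi)], so
    that [wave_detuning] has slope [D > 0] and [wave_lam] slope [- S] at [w0].
    The sign that decides is that of [L = D + S gamma].

    Branch ([rotating_wave_branch]). The symmetry [z -> e^{i theta} z] of the
    equation suggests rotating waves [r e^{i om t}], and these are solutions
    exactly when [wave_lam om - lam = r^2] and [wave_detuning om = gamma r^2].
    Since [D > 0], putting [om = w0 + gamma s] makes the second equation
    solvable for [r^2] with [r^2 > 0] for all small [s > 0]; the first one then
    defines [lam].

    Direction ([near_bifurcation_lam_side]). An arbitrary periodic solution
    near the bifurcation is not shown to be a rotating wave. Instead the
    equation is tested against [e^{i om t}], [om] being the frequency of the
    solution: taking the mean over a period of the equation for
    [v = z e^{- i om t} / a] removes the derivative and turns the delay into the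
    factor [e^{- i om tau}], which leaves [char_fun_periodic]:
      char_fun (i om) = (1 + i gamma) |a|^2 m  with  m close to 1.
    The imaginary part gives [om - w0] as approximately [gamma |a|^2 / D]; the
    real part then gives [lam - lam0] as approximately [- |a|^2 L / D].
    So [lam - lam0] has the sign opposite to that of [L].

    Crossing ([critical_root_crossing]). The characteristic function is
    [G mu - lam], with [G] an entire function whose derivative at [i w0] has
    real part [D]. Hence [G] has a local inverse near [i w0], found by
    contraction; [mu lam] is the value of that inverse at the real number [lam],
    and [D > 0] makes [Re (mu lam)] have the sign of [lam - lam0]. *)

(** * Real functions near a point *)

Lemma continuous_delta (f : R -> R) (x0 e : R) : continuous f x0 -> 0 < e ->
  exists r : R, 0 < r /\ forall x : R, Rabs (x - x0) < r -> Rabs (f x - f x0) < e.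
Proof.
  intros Hf He.
  apply (filterlim_locally (U := R_UniformSpace)) with (eps := mkposreal e He) in Hf.
  destruct Hf as [r Hr]. exists r. split; [apply cond_pos|]. exact Hr.
Qed.

Lemma is_derive_slope (f : R -> R) (x0 l k : R) : is_derive f x0 l -> 0 < k ->
  exists r : R, 0 < r /\ forall x : R, Rabs (x - x0) < r ->
    exists d : R, Rabs d <= k /\ f x - f x0 = (l + d) * (x - x0).
Proof.
  intros Hf Hk. apply is_derive_Reals in Hf.
  destruct (Hf k Hk) as [r Hr]. exists r. split; [apply cond_pos|].
  intros x Hx. destruct (Req_dec x x0) as [->|Hne].
  - exists 0. rewrite Rabs_R0. split; [lra|ring].
  - assert (Hh : x - x0 <> 0) by lra.
    specialize (Hr _ Hh Hx). replace (x0 + (x - x0)) with x in Hr by ring.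
    exists ((f x - f x0) / (x - x0) - l). split; [lra|now field].
Qed.

(** * Complex-valued functions of a real variable *)

Lemma norm_C_R (w : C) : norm (w : C_R_NormedModule) = Cmod w.
Proof.
  destruct w as [x y].
  change (norm ((x, y) : C_R_NormedModule)) with
    (sqrt (Rabs x ^ 2 + Rabs y ^ 2)).
  unfold Cmod; cbn [fst snd]. now rewrite !pow2_abs.
Qed.

Lemma Cmod_le_Rabs (w : C) : Cmod w <= Rabs (Re w) + Rabs (Im w).
Proof.
  unfold Cmod, Re, Im.
  apply Rsqr_incr_0_var; [|pose proof (Rabs_pos (fst w)); pose proof (Rabs_pos (snd w)); lra].
  rewrite Rsqr_sqrt by nra.
  unfold Rsqr. rewrite <- (pow2_abs (fst w)), <- (pow2_abs (snd w)).
  pose proof (Rabs_pos (fst w)); pose proof (Rabs_pos (snd w)). nra.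
Qed.

Lemma im_le_Cmod (w : C) : Rabs (Im w) <= Cmod w.
Proof.
  eapply Rle_trans; [|apply Rmax_Cmod]. apply Rmax_r.
Qed.

Lemma Cmod_minus_sym (u v : C) : Cmod (u - v) = Cmod (v - u).
Proof. rewrite <- Cmod_opp. f_equal. ring. Qed.

Lemma Cmod_triangle_minus (u v w : C) : Cmod (u - w) <= Cmod (u - v) + Cmod (v - w).
Proof.
  replace (u - w)%C with ((u - v) + (v - w))%C by ring. apply Cmod_triangle.
Qed.

Lemma Cmod_minus_le (u v : C) : Cmod u - Cmod v <= Cmod (u - v).
Proof.
  pose proof (Cmod_triangle (u - v) v) as H.
  replace (u - v + v)%C with u in H by ring. lra.
Qed.

Lemma continuous_C {U : UniformSpace} (f : U -> C) (t : U) :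
  continuous (fun s => Re (f s)) t -> continuous (fun s => Im (f s)) t ->
  continuous f t.
Proof.
  intros Hr Hi.
  apply (continuous_ext (fun s => ((Re (f s), Im (f s)) : C))).
  { intros s. now destruct (f s). }
  apply (continuous_comp_2 (fun s => Re (f s)) (fun s => Im (f s))
           (fun x y : R => ((x, y) : C)) t Hr Hi).
  apply (continuous_ext (fun p : R * R => p)).
  { now intros []. }
  apply continuous_id.
Qed.

Lemma continuous_Re {U : UniformSpace} (f : U -> C) (t : U) :
  continuous f t -> continuous (fun s => Re (f s)) t.
Proof.
  intros H. apply (continuous_comp f Re); [exact H|].
  destruct (f t) as [x y]. apply (continuous_fst (U := R_UniformSpace) (V := R_UniformSpace)).
Qed.

Lemma continuous_Im {U : UniformSpace} (f : U -> C) (t : U) :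
  continuous f t -> continuous (fun s => Im (f s)) t.
Proof.
  intros H. apply (continuous_comp f Im); [exact H|].
  destruct (f t) as [x y]. apply (continuous_snd (U := R_UniformSpace) (V := R_UniformSpace)).
Qed.

Lemma continuous_Cmult {U : UniformSpace} (f g : U -> C) (t : U) :
  continuous f t -> continuous g t -> continuous (fun s => (f s * g s)%C) t.
Proof.
  intros Hf Hg.
  pose proof (continuous_Re f t Hf). pose proof (continuous_Im f t Hf).
  pose proof (continuous_Re g t Hg). pose proof (continuous_Im g t Hg).
  apply continuous_C.
  - apply (continuous_minus (V := R_NormedModule)
             (fun s => Re (f s) * Re (g s)) (fun s => Im (f s) * Im (g s)));
      now apply (continuous_mult (K := R_AbsRing)).
  - apply (continuous_plus (V := R_NormedModule)
             (fun s => Re (f s) * Im (g s)) (fun s => Im (f s) * Re (g s)));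
      now apply (continuous_mult (K := R_AbsRing)).
Qed.

Lemma continuous_RtoC {U : UniformSpace} (f : U -> R) (t : U) :
  continuous f t -> continuous (fun s => RtoC (f s)) t.
Proof.
  intros Hf. apply continuous_C; [exact Hf|].
  apply (continuous_const (V := R_UniformSpace)).
Qed.

Lemma is_derive_C (f : R -> C) (t : R) (l : C) :
  is_derive (fun s => Re (f s)) t (Re l) -> is_derive (fun s => Im (f s)) t (Im l) ->
  is_derive (K := R_AbsRing) (V := C_R_NormedModule) f t l.
Proof.
  intros Hr Hi. split.
  { apply (is_linear_scal_l (K := R_AbsRing) (V := C_R_NormedModule) l). }
  intros x Hx eps.
  pose proof (is_filter_lim_locally_unique _ _ Hx) as <-.
  pose (e2 := mkposreal (eps / 2) (is_pos_div_2 eps)).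
  destruct Hr as [_ Hr]; destruct Hi as [_ Hi].
  specialize (Hr t (fun P H => H) e2). specialize (Hi t (fun P H => H) e2).
  generalize (filter_and _ _ Hr Hi). apply filter_imp. clear Hr Hi.
  intros y [Hr Hi].
  change (norm (y - t)) with (Rabs (y - t)) in *.
  match goal with |- norm ?w <= _ => rewrite (norm_C_R w);
    set (d := w) in * end.
  apply (Rle_trans _ _ _ (Cmod_le_Rabs d)).
  change (Rabs (Re d) <= eps / 2 * Rabs (y - t)) in Hr.
  change (Rabs (Im d) <= eps / 2 * Rabs (y - t)) in Hi.
  change (norm (minus y t)) with (Rabs (y - t)). lra.
Qed.

Lemma is_derive_Re (f : R -> C) (t : R) (l : C) :
  is_derive (K := R_AbsRing) (V := C_R_NormedModule) f t l ->
  is_derive (fun s => Re (f s)) t (Re l).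
Proof.
  intros H.
  apply (filterdiff_comp f (fun w : C_R_NormedModule => Re w) _ (fun w => Re w) H).
  apply filterdiff_linear.
  apply (is_linear_fst (U := R_NormedModule) (V := R_NormedModule)).
Qed.

Lemma is_derive_Im (f : R -> C) (t : R) (l : C) :
  is_derive (K := R_AbsRing) (V := C_R_NormedModule) f t l ->
  is_derive (fun s => Im (f s)) t (Im l).
Proof.
  intros H.
  apply (filterdiff_comp f (fun w : C_R_NormedModule => Im w) _ (fun w => Im w) H).
  apply filterdiff_linear.
  apply (is_linear_snd (U := R_NormedModule) (V := R_NormedModule)).
Qed.

Lemma is_derive_Cmult (f g : R -> C) (t : R) (df dg : C) :
  is_derive (K := R_AbsRing) (V := C_R_NormedModule) f t df ->
  is_derive (K := R_AbsRing) (V := C_R_NormedModule) g t dg ->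
  is_derive (K := R_AbsRing) (V := C_R_NormedModule)
    (fun s => (f s * g s)%C) t (df * g t + f t * dg)%C.
Proof.
  intros Hf Hg.
  pose proof (is_derive_Re f t df Hf). pose proof (is_derive_Im f t df Hf).
  pose proof (is_derive_Re g t dg Hg). pose proof (is_derive_Im g t dg Hg).
  assert (HM : forall (p q : R -> R) (dp dq : R), is_derive p t dp -> is_derive q t dq ->
    is_derive (fun s => p s * q s) t (dp * q t + p t * dq)).
  { intros. apply (is_derive_mult (K := R_AbsRing)); auto. intros; apply Rmult_comm. }
  apply is_derive_C.
  - replace (Re (df * g t + f t * dg)) with
      (minus (Re df * Re (g t) + Re (f t) * Re dg) (Im df * Im (g t) + Im (f t) * Im dg))
      by (rewrite re_plus, !re_mult; unfold minus, plus, opp; simpl; ring).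
    apply (is_derive_minus (V := R_NormedModule) (fun s => Re (f s) * Re (g s)) (fun s => Im (f s) * Im (g s))); now apply HM.
  - replace (Im (df * g t + f t * dg)) with
      (plus (Re df * Im (g t) + Re (f t) * Im dg) (Im df * Re (g t) + Im (f t) * Re dg))
      by (rewrite im_plus, !im_mult; unfold plus; simpl; ring).
    apply (is_derive_plus (V := R_NormedModule) (fun s => Re (f s) * Im (g s)) (fun s => Im (f s) * Re (g s))); now apply HM.
Qed.

(** * The complex exponential *)

Lemma Cexp_Ci (x : R) : Cexp (Ci * RtoC x) = (cos x, sin x).
Proof.
  unfold Cexp.
  replace (Re (Ci * RtoC x)) with 0 by (unfold Ci, RtoC, Re; simpl; ring).
  replace (Im (Ci * RtoC x)) with x by (unfold Ci, RtoC, Im; simpl; ring).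
  rewrite exp_0. apply Cmult_1_l.
Qed.

Lemma Cexp_plus (u v : C) : Cexp (u + v) = (Cexp u * Cexp v)%C.
Proof.
  unfold Cexp. rewrite re_plus, im_plus, exp_plus, cos_plus, sin_plus.
  unfold RtoC, Cmult; simpl. f_equal; ring.
Qed.

Lemma Cexp_0 : Cexp 0 = RtoC 1.
Proof.
  unfold Cexp. simpl. rewrite exp_0, cos_0, sin_0. apply Cmult_1_l.
Qed.

Lemma Cmod_Cexp (w : C) : Cmod (Cexp w) = exp (Re w).
Proof.
  unfold Cexp. rewrite Cmod_mult, Cmod_R, Rabs_pos_eq by (left; apply exp_pos).
  replace (Cmod (cos (Im w), sin (Im w))) with 1; [ring|].
  unfold Cmod; cbn [fst snd]. rewrite <- !Rsqr_pow2, Rplus_comm, sin2_cos2.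
  symmetry; apply sqrt_1.
Qed.

Lemma Cmod_Cexp_Ci (x : R) : Cmod (Cexp (Ci * RtoC x)) = 1.
Proof.
  rewrite Cmod_Cexp. replace (Re (Ci * RtoC x)) with 0; [apply exp_0|].
  unfold Ci, RtoC, Re; simpl; ring.
Qed.

Lemma Cexp_Ci_plus (x y : R) :
  Cexp (Ci * RtoC (x + y)) = (Cexp (Ci * RtoC x) * Cexp (Ci * RtoC y))%C.
Proof. rewrite <- Cexp_plus, RtoC_plus. f_equal. ring. Qed.

Lemma is_derive_Cexp_Ci (om t : R) :
  is_derive (K := R_AbsRing) (V := C_R_NormedModule)
    (fun s => Cexp (Ci * RtoC (om * s))) t
    (Ci * RtoC om * Cexp (Ci * RtoC (om * t)))%C.
Proof.
  apply is_derive_C.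
  - apply (is_derive_ext (fun s => cos (om * s))).
    { intros s. now rewrite Cexp_Ci. }
    rewrite Cexp_Ci. unfold Ci, RtoC, Re; simpl. auto_derive; [easy|]. simpl. ring.
  - apply (is_derive_ext (fun s => sin (om * s))).
    { intros s. now rewrite Cexp_Ci. }
    rewrite Cexp_Ci. unfold Ci, RtoC, Im; simpl. auto_derive; [easy|ring].
Qed.

Lemma continuous_Cexp_Ci {U : UniformSpace} (f : U -> R) (t : U) :
  continuous f t -> continuous (fun s => Cexp (Ci * RtoC (f s))) t.
Proof.
  intros Hf. apply (continuous_ext (fun s => ((cos (f s), sin (f s)) : C))).
  { intros s. now rewrite Cexp_Ci. }
  apply continuous_C.
  - apply (continuous_comp f cos); [exact Hf|apply continuous_cos].
  - apply (continuous_comp f sin); [exact Hf|apply continuous_sin].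
Qed.

Lemma Cexp_Ci_lipschitz (x y : R) :
  Cmod (Cexp (Ci * RtoC x) - Cexp (Ci * RtoC y)) <= Rabs (x - y).
Proof.
  replace (Cexp (Ci * RtoC x)) with (Cexp (Ci * RtoC y) * Cexp (Ci * RtoC (x - y)))%C
    by (rewrite <- Cexp_Ci_plus; do 3 f_equal; ring).
  set (d := x - y).
  replace (Cexp (Ci * RtoC y) * Cexp (Ci * RtoC d) - Cexp (Ci * RtoC y))%C
    with (Cexp (Ci * RtoC y) * (Cexp (Ci * RtoC d) - 1))%C by ring.
  rewrite Cmod_mult, Cmod_Cexp_Ci, Rmult_1_l.
  assert (Hsin : forall u, Rabs (sin u) <= Rabs u).
  { assert (Hpos : forall u, 0 < u -> Rabs (sin u) <= u).
    { intros u Hu. pose proof (sin_lt_x u Hu). pose proof (SIN_bound u). pose proof PI2_1.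
      apply Rabs_le. split; [|lra].
      destruct (Rle_lt_dec u PI).
      - pose proof (sin_ge_0 u). lra.
      - lra. }
    intros u. destruct (Rtotal_order u 0) as [Hu|[->|Hu]].
    - rewrite (Rabs_left u Hu), <- Rabs_Ropp, <- sin_neg. apply Hpos. lra.
    - rewrite sin_0. lra.
    - rewrite (Rabs_pos_eq u) by lra. now apply Hpos. }
  apply Rsqr_incr_0_var; [|apply Rabs_pos].
  rewrite !Rsqr_pow2, Cmod2_alt, pow2_abs, Cexp_Ci.
  assert (Ec : cos d = 1 - 2 * sin (d / 2) * sin (d / 2))
    by (rewrite <- cos_2a_sin; f_equal; field).
  assert (Es : sin d = 2 * sin (d / 2) * cos (d / 2))
    by (rewrite <- sin_2a; f_equal; field).
  unfold Re, Im, RtoC; simpl. rewrite Ec, Es.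
  pose proof (sin2_cos2 (d / 2)) as H. unfold Rsqr in H.
  specialize (Hsin (d / 2)). apply Rsqr_le_abs_1 in Hsin. unfold Rsqr in Hsin.
  nra.
Qed.

(** * The mean of the equation over a period *)

Lemma is_RInt_Cmult_l (c : C) (f : R -> C) (a b : R) (l : C) :
  is_RInt (V := C_R_NormedModule) f a b l ->
  is_RInt (V := C_R_NormedModule) (fun t => (c * f t)%C) a b (c * l)%C.
Proof.
  intros H.
  pose proof (is_RInt_fct_extend_fst (U := R_NormedModule) (V := R_NormedModule) f a b l H) as Hr.
  pose proof (is_RInt_fct_extend_snd (U := R_NormedModule) (V := R_NormedModule) f a b l H) as Hi.
  pose proof (fun k : R => is_RInt_scal _ a b k _ Hr) as Sr.
  pose proof (fun k : R => is_RInt_scal _ a b k _ Hi) as Si.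
  apply (is_RInt_fct_extend_pair (U := R_NormedModule) (V := R_NormedModule)
           (fun t => (c * f t)%C) a b).
  - exact (is_RInt_minus _ _ _ _ _ _ (Sr (fst c)) (Si (snd c))).
  - exact (is_RInt_plus _ _ _ _ _ _ (Si (fst c)) (Sr (snd c))).
Qed.

(** A delay disappears from the mean of a periodic function: the integrals over
    [[- s, 0]] and [[T - s, T]] cancel. *)
Lemma RInt_periodic_shift {V : CompleteNormedModule R_AbsRing} (f : R -> V) (T s : R) :
  (forall t, continuous f t) -> (forall t, f (t + T) = f t) ->
  is_RInt (fun t => f (t - s)) 0 T (RInt f 0 T).
Proof.
  intros Hc Hp.
  assert (Hex : forall a b, ex_RInt f a b) by (intros; apply ex_RInt_continuous; auto).
  assert (Hshift : forall u a b, is_RInt (fun t => f (t + u)) a b (RInt f (a + u) (b + u))).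
  { intros u a b.
    apply (is_RInt_ext (fun t => scal 1 (f (1 * t + u)))).
    { intros t _. rewrite Rmult_1_l. apply (scal_one (K := R_AbsRing)). }
    apply (is_RInt_comp_lin f 1 u a b).
    rewrite !Rmult_1_l. apply RInt_correct, Hex. }
  assert (Hend : RInt f T (T - s) = RInt f 0 (- s)).
  { replace (RInt f T (T - s)) with (RInt f (0 + T) (- s + T)) by (f_equal; ring).
    rewrite <- (is_RInt_unique _ _ _ _ (Hshift T 0 (- s))).
    apply RInt_ext. intros t _. apply Hp. }
  assert (HE : RInt f (0 - s) (T - s) = RInt f 0 T).
  { rewrite <- (RInt_Chasles f (0 - s) 0 (T - s)) by apply Hex.
    rewrite <- (RInt_Chasles f 0 T (T - s)) by apply Hex.
    replace (0 - s) with (- s) by ring.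
    rewrite Hend, <- (opp_RInt_swap f 0 (- s)) by apply Hex.
    rewrite (plus_comm (RInt f 0 T)), plus_assoc.
    etransitivity; [|apply plus_zero_l]. f_equal. apply (plus_opp_l (RInt f 0 (- s))). }
  rewrite <- HE. exact (Hshift (- s) 0 T).
Qed.

Lemma Cmod_is_RInt_minus_le (f : R -> C) (T k : R) (l : C) : 0 <= T ->
  (forall t, 0 <= t <= T -> Cmod (f t - 1) <= k) ->
  is_RInt (V := C_R_NormedModule) f 0 T l -> Cmod (l - RtoC T) <= T * k.
Proof.
  intros HT Hk Hf.
  pose proof (is_RInt_minus _ _ _ _ _ _ Hf (is_RInt_const (V := C_R_NormedModule) 0 T (RtoC 1))) as H.
  replace (l - RtoC T)%C with
    (minus (l : C_R_NormedModule) (scal (T - 0) (RtoC 1 : C_R_NormedModule))).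
  2:{ rewrite scal_R_Cmult. change (l - RtoC (T - 0) * 1 = l - RtoC T)%C.
      rewrite Rminus_0_r. ring. }
  rewrite <- norm_C_R. replace (T * k) with ((T - 0) * k) by ring.
  refine (norm_RInt_le_const _ 0 T _ k HT _ H).
  intros t Ht. etransitivity; [right; exact (norm_C_R (f t - 1)%C)|now apply Hk].
Qed.

Lemma cubic_near_one (v : C) (k : R) : k <= 1 -> Cmod (v - 1) <= k ->
  Cmod (RtoC (Cmod v ^ 2) * v - 1) <= 7 * k.
Proof.
  intros Hk Hv.
  assert (Hup : Cmod v <= 1 + k).
  { pose proof (Cmod_minus_le v 1). rewrite Cmod_1 in H. lra. }
  assert (Hlo : 1 - k <= Cmod v).
  { pose proof (Cmod_minus_le 1 v). rewrite Cmod_1, Cmod_minus_sym in H. lra. }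
  replace (RtoC (Cmod v ^ 2) * v - 1)%C with
    (RtoC (Cmod v ^ 2) * (v - 1) + RtoC (Cmod v ^ 2 - 1))%C
    by (rewrite RtoC_minus; ring).
  eapply Rle_trans; [apply Cmod_triangle|].
  rewrite Cmod_mult, !Cmod_R.
  pose proof (Cmod_ge_0 v). pose proof (Cmod_ge_0 (v - 1)).
  rewrite (Rabs_pos_eq (Cmod v ^ 2)) by nra.
  assert (Rabs (Cmod v ^ 2 - 1) <= 3 * k) by (apply Rabs_le; nra).
  assert (Cmod v ^ 2 * Cmod (v - 1) <= 4 * k); [|lra].
  apply Rmult_le_compat; nra.
Qed.

(** The solvability condition behind the direction of bifurcation: the mean over
    a period of the equation satisfied by [v = z e^{- i om t} / a]. The
    derivative integrates to zero, the delayed term to a multiple of the mean of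
    [v], and the witness [m] is the mean of [|v|^2 v] divided by the mean of
    [v]; both means are close to [1] because [v] is. *)
Lemma char_fun_periodic (K gamma beta tau lam T om k : R) (z : R -> C) (a : C) :
  dde_solution K gamma beta tau lam z -> 0 < T -> (forall t, z (t + T) = z t) ->
  Cexp (Ci * RtoC (om * T)) = RtoC 1 -> a <> RtoC 0 -> k <= / 2 ->
  (forall t, 0 <= t <= T ->
     Cmod (z t - a * Cexp (Ci * RtoC (om * t))) <= k * Cmod a) ->
  exists m : C, Cmod (m - 1) <= 16 * k /\
    char_fun K beta tau lam (Ci * RtoC om) =
      ((RtoC 1 + Ci * RtoC gamma) * RtoC (Cmod a ^ 2) * m)%C.
Proof.
  intros Hz HT Hper Hom Ha Hk Hnear.
  pose (v := fun t => (z t * Cexp (Ci * RtoC (- om * t)) * / a)%C).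
  assert (Hunit : forall t, (Cexp (Ci * RtoC (om * t)) * Cexp (Ci * RtoC (- om * t)) = 1)%C).
  { intros t. rewrite <- Cexp_Ci_plus.
    replace (om * t + - om * t) with 0 by ring. rewrite Cmult_0_r. apply Cexp_0. }
  assert (Hvper : forall t, v (t + T) = v t).
  { intros t. unfold v. rewrite Hper, Rmult_plus_distr_l, Cexp_Ci_plus.
    pose proof (Hunit T) as HU. rewrite Hom, Cmult_1_l in HU. rewrite HU. ring. }
  assert (Hzc : forall t, continuous z t).
  { intros t. apply (ex_derive_continuous (V := C_R_NormedModule)). eexists. apply Hz. }
  assert (Hvc : forall t, continuous v t).
  { intros t. apply (continuous_Cmult (fun t => (z t * Cexp (Ci * RtoC (- om * t)))%C) (fun _ => / a)%C).
    - apply continuous_Cmult; [apply Hzc|].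
      apply continuous_Cexp_Ci. apply (continuous_scal_r (V := R_NormedModule)).
      apply continuous_id.
    - apply continuous_const. }
  assert (Hzv : forall t, z t = (a * v t * Cexp (Ci * RtoC (om * t)))%C).
  { intros t. unfold v.
    transitivity (z t * (Cexp (Ci * RtoC (om * t)) * Cexp (Ci * RtoC (- om * t))))%C.
    - rewrite Hunit. ring.
    - now field. }
  assert (Hmod : forall t, Cmod (z t) = Cmod a * Cmod (v t)).
  { intros t. rewrite Hzv, !Cmod_mult, Cmod_Cexp_Ci. ring. }
  assert (Ha' : 0 < Cmod a) by now apply Cmod_gt_0.
  assert (Hv1 : forall t, 0 <= t <= T -> Cmod (v t - 1) <= k).
  { intros t Ht. specialize (Hnear t Ht). rewrite Hzv in Hnear.
    replace (a * v t * Cexp (Ci * RtoC (om * t)) - a * Cexp (Ci * RtoC (om * t)))%C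
      with (a * (v t - 1) * Cexp (Ci * RtoC (om * t)))%C in Hnear by ring.
    rewrite !Cmod_mult, Cmod_Cexp_Ci in Hnear. nra. }
  pose (cub := fun t => (RtoC (Cmod (v t) ^ 2) * v t)%C).
  assert (Hcubc : forall t, continuous cub t).
  { intros t. apply continuous_Cmult; [|apply Hvc]. apply continuous_RtoC.
    apply (continuous_ext (fun s => Re (v s) * Re (v s) + Im (v s) * Im (v s))).
    { intros s. rewrite Cmod2_alt. simpl. ring. }
    pose proof (continuous_Re v t (Hvc t)). pose proof (continuous_Im v t (Hvc t)).
    apply (continuous_plus (V := R_NormedModule)
             (fun s => Re (v s) * Re (v s)) (fun s => Im (v s) * Im (v s)));
      now apply (continuous_mult (K := R_AbsRing)). }
  pose (E := (RtoC K * Cexp (Ci * RtoC beta))%C).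
  (* With these abbreviations v' = A v + B v(. - tau) + Q |v|^2 v, and
     char_fun (i om) = - (A + B). *)
  pose (A := (RtoC lam + Ci - Ci * RtoC om - E)%C).
  pose (B := (E * Cexp (Ci * RtoC (- om * tau)))%C).
  pose (Q := ((RtoC 1 + Ci * RtoC gamma) * RtoC (Cmod a ^ 2))%C).
  pose (dv := fun t => (A * v t + B * v (t - tau)%R + Q * cub t)%C).
  assert (Hdv : forall t, is_derive (V := C_R_NormedModule) v t (dv t)).
  { intros t.
    pose proof (is_derive_Cmult _ _ t _ _ (is_derive_Cmult _ _ t _ _ (Hz t) (is_derive_Cexp_Ci (- om) t))
      (is_derive_const (V := C_R_NormedModule) (/ a)%C t)) as H.
    refine (eq_rect _ (fun d => is_derive v t d) H _ _).
    match goal with |- ?x = ?y => change (@eq C x y) end.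
    change (zero : C_R_NormedModule) with (RtoC 0).
    unfold dv, cub. rewrite Hmod.
    replace (v (t - tau)) with
      (z (t - tau)%R * (Cexp (Ci * RtoC (- om * t)) * Cexp (Ci * RtoC (om * tau))) * / a)%C.
    2:{ rewrite <- Cexp_Ci_plus. unfold v.
        now replace (- om * t + om * tau) with (- om * (t - tau)) by ring. }
    unfold B.
    transitivity (A * v t + E * (Cexp (Ci * RtoC (om * tau)) * Cexp (Ci * RtoC (- om * tau)))
      * (z (t - tau)%R * Cexp (Ci * RtoC (- om * t)) * / a)
      + Q * (RtoC (Cmod (v t) ^ 2) * v t))%C; [|ring].
    rewrite Hunit. unfold Q.
    replace (RtoC ((Cmod a * Cmod (v t)) ^ 2)) with (RtoC (Cmod a ^ 2) * RtoC (Cmod (v t) ^ 2))%C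
      by (rewrite <- RtoC_mult; f_equal; ring).
    unfold v at 2 4. unfold A, E. rewrite RtoC_opp. ring. }
  assert (Hex : forall f : R -> C, (forall t, continuous f t) ->
    is_RInt (V := C_R_NormedModule) f 0 T (RInt (V := C_R_CompleteNormedModule) f 0 T)).
  { intros f Hf. apply (RInt_correct (V := C_R_CompleteNormedModule)).
    apply (ex_RInt_continuous (V := C_R_CompleteNormedModule)). intros; apply Hf. }
  pose proof (Hex v Hvc) as Hc. pose proof (Hex cub Hcubc) as Hn.
  pose proof (RInt_periodic_shift (V := C_R_CompleteNormedModule) v T tau Hvc Hvper) as Hs.
  set (c := RInt (V := C_R_CompleteNormedModule) v 0 T) in *.
  set (n := RInt (V := C_R_CompleteNormedModule) cub 0 T) in *.
  assert (Hbal : (A * c + B * c + Q * n = 0)%C).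
  { pose proof (is_RInt_plus _ _ _ _ _ _
      (is_RInt_plus _ _ _ _ _ _ (is_RInt_Cmult_l A _ _ _ _ Hc) (is_RInt_Cmult_l B _ _ _ _ Hs))
      (is_RInt_Cmult_l Q _ _ _ _ Hn)) as H1.
    assert (H2 : is_RInt (V := C_R_CompleteNormedModule) dv 0 T (minus (v T) (v 0))).
    { apply (is_RInt_derive (V := C_R_CompleteNormedModule)); [intros; apply Hdv|].
      intros t _.
      assert (Hshift : continuous (fun s => v (s - tau)) t).
      { apply (continuous_comp (fun s => s - tau) v); [|apply Hvc].
        apply (continuous_minus (V := R_NormedModule) (fun s => s) (fun _ => tau));
          [apply continuous_id|apply continuous_const]. }
      apply (continuous_plus (V := C_R_NormedModule)
               (fun s => A * v s + B * v (s - tau)%R)%C (fun s => Q * cub s)%C).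
      - apply (continuous_plus (V := C_R_NormedModule)
                 (fun s => A * v s)%C (fun s => B * v (s - tau)%R)%C);
          apply continuous_Cmult; auto using continuous_const.
      - apply continuous_Cmult; auto using continuous_const. }
    apply (is_RInt_unique (V := C_R_CompleteNormedModule)) in H1.
    apply (is_RInt_unique (V := C_R_CompleteNormedModule)) in H2.
    transitivity (v T - v 0)%C.
    - etransitivity; [symmetry; exact H1|exact H2].
    - rewrite <- (Hvper 0), Rplus_0_l. ring. }
  assert (Hc1 : Cmod (c - RtoC T) <= T * k) by (apply (Cmod_is_RInt_minus_le v); auto; lra).
  assert (Hn1 : Cmod (n - RtoC T) <= T * (7 * k)).
  { apply (Cmod_is_RInt_minus_le cub); auto; [lra|].
    intros t Ht. apply cubic_near_one; auto; lra. }
  assert (Hc2 : T / 2 <= Cmod c).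
  { pose proof (Cmod_minus_le T c) as H. rewrite Cmod_R, Rabs_pos_eq, Cmod_minus_sym in H by lra.
    nra. }
  assert (Hc0 : c <> RtoC 0) by (apply Cmod_gt_0; lra).
  (* |n - c| <= 8 k T and |c| >= T / 2, hence the factor 16. *)
  exists (n / c)%C. split.
  - replace (n / c - 1)%C with ((n - c) / c)%C by now field.
    rewrite Cmod_div by exact Hc0.
    apply Rle_div_l; [lra|].
    pose proof (Cmod_triangle_minus n T c) as H.
    rewrite (Cmod_minus_sym T c) in H.
    assert (0 <= k) by (pose proof (Cmod_ge_0 (c - T)); nra).
    nra.
  - assert (Hchi : char_fun K beta tau lam (Ci * RtoC om) = (- (A + B))%C).
    { unfold char_fun, A, B, E.
      replace (- (Ci * RtoC om * RtoC tau))%C with (Ci * RtoC (- om * tau))%C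
        by (rewrite RtoC_mult, RtoC_opp; ring).
      ring. }
    rewrite Hchi. fold Q.
    replace (Q * (n / c))%C with (((A * c + B * c + Q * n) - (A + B) * c) / c)%C by now field.
    rewrite Hbal. now field.
Qed.

(** * A local inverse by contraction *)

(** Taking the limit of the iterates componentwise with the total operator
    [Lim_seq] makes the fixed point a function of the map iterated, so the root
    [mu lam] depends on [lam] without an appeal to choice. *)
Definition iteration_limit (N : C -> C) (m0 : C) : C :=
  (real (Lim_seq (fun n => Re (Nat.iter n N m0))),
   real (Lim_seq (fun n => Im (Nat.iter n N m0)))).

Lemma contraction_fixed_point (N : C -> C) (m0 : C) (r : R) : 0 < r ->
  (forall u, Cmod (u - m0) <= r -> Cmod (N u - m0) <= r) ->
  (forall u v, Cmod (u - m0) <= r -> Cmod (v - m0) <= r ->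
     Cmod (N u - N v) <= / 2 * Cmod (u - v)) ->
  Cmod (iteration_limit N m0 - m0) <= r /\
  N (iteration_limit N m0) = iteration_limit N m0.
Proof.
  intros Hr Hball Hcontr.
  set (x := fun n => Nat.iter n N m0).
  assert (Hx : forall n, Cmod (x n - m0) <= r).
  { induction n as [|n IH]; [|now apply Hball].
    unfold x; simpl. replace (m0 - m0)%C with (RtoC 0) by ring. rewrite Cmod_0. lra. }
  assert (Hcauchy : forall n m, Cmod (x (n + m)%nat - x n) <= (/ 2) ^ n * r).
  { induction n as [|n IH]; intros m.
    - simpl. rewrite Rmult_1_l. apply Hx.
    - eapply Rle_trans; [apply (Hcontr (x (n + m)%nat) (x n)); apply Hx|].
      specialize (IH m). simpl. lra. }
  assert (Hsmall : forall eps, 0 < eps -> exists n, (/ 2) ^ n * r < eps).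
  { intros eps Heps.
    destruct (pow_lt_1_zero (/ 2)) with (y := eps / r) as [n Hn].
    - rewrite Rabs_pos_eq; lra.
    - now apply Rdiv_lt_0_compat.
    - exists n. specialize (Hn n (le_n n)).
      rewrite Rabs_pos_eq in Hn by (apply pow_le; lra).
      apply (Rlt_div_r _ _ _ Hr) in Hn. exact Hn. }
  assert (Hlim : forall p : C -> R, (forall u v, Rabs (p u - p v) <= Cmod (u - v)) ->
    is_lim_seq (fun n => p (x n)) (real (Lim_seq (fun n => p (x n))))).
  { intros p Hp. apply Lim_seq_correct', ex_lim_seq_cauchy_corr.
    intros eps. destruct (Hsmall (eps / 2)) as [n0 Hn0]; [apply is_pos_div_2|].
    exists n0. intros n m Hn Hm.
    eapply Rle_lt_trans; [apply Hp|].
    eapply Rle_lt_trans; [apply (Cmod_triangle_minus _ (x n0))|].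
    rewrite (Cmod_minus_sym (x n0)).
    pose proof (Hcauchy n0 (n - n0)%nat) as H1. pose proof (Hcauchy n0 (m - n0)%nat) as H2.
    replace (n0 + (n - n0))%nat with n in H1 by lia.
    replace (n0 + (m - n0))%nat with m in H2 by lia. lra. }
  assert (Hre : forall u v, Rabs (Re u - Re v) <= Cmod (u - v)).
  { intros u v. replace (Re u - Re v) with (Re (u - v)) by (unfold Re; simpl; ring).
    apply re_le_Cmod. }
  assert (Him : forall u v, Rabs (Im u - Im v) <= Cmod (u - v)).
  { intros u v. replace (Im u - Im v) with (Im (u - v)) by (unfold Im; simpl; ring).
    apply im_le_Cmod. }
  pose proof (Hlim Re Hre) as Lr. pose proof (Hlim Im Him) as Li.
  set (L := iteration_limit N m0).
  assert (HL : forall eps, 0 < eps -> exists n0, forall n, (n0 <= n)%nat -> Cmod (x n - L) < eps).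
  { intros eps Heps. apply is_lim_seq_spec in Lr, Li.
    assert (He : 0 < eps / 2) by lra.
    destruct (Lr (mkposreal _ He)) as [n1 H1]. destruct (Li (mkposreal _ He)) as [n2 H2].
    exists (Nat.max n1 n2). intros n Hn.
    specialize (H1 n ltac:(lia)). specialize (H2 n ltac:(lia)). simpl in H1, H2.
    eapply Rle_lt_trans; [apply Cmod_le_Rabs|].
    replace (Re (x n - L)) with (Re (x n) - Re L) by reflexivity.
    replace (Im (x n - L)) with (Im (x n) - Im L) by reflexivity.
    change (Re L) with (real (Lim_seq (fun n => Re (x n)))).
    change (Im L) with (real (Lim_seq (fun n => Im (x n)))).
    lra. }
  assert (HLball : Cmod (L - m0) <= r).
  { apply Rnot_lt_le. intros Hlt.
    destruct (HL (Cmod (L - m0) - r)) as [n Hn]; [lra|].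
    specialize (Hn n (le_n n)). pose proof (Cmod_triangle_minus L (x n) m0) as H.
    rewrite (Cmod_minus_sym L (x n)) in H. specialize (Hx n). lra. }
  split; [exact HLball|].
  apply Ceq_minus, Cmod_eq_0, Rle_antisym; [|apply Cmod_ge_0].
  apply Rnot_lt_le. intros Hlt.
  destruct (HL (Cmod (N L - L) / 2)) as [n Hn]; [lra|].
  pose proof (Hn n (le_n n)) as H1. pose proof (Hn (S n) ltac:(lia)) as H2.
  pose proof (Hcontr L (x n) HLball (Hx n)) as H3.
  rewrite (Cmod_minus_sym L (x n)) in H3.
  pose proof (Cmod_triangle_minus (N L) (x (S n)) L) as H4.
  change (x (S n)) with (N (x n)) in *. lra.
Qed.

(** Differentiability uniform in both points near [m0]: this is what makes
    the Newton map of [real_preimage_curve] a contraction. *)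
Definition strict_C_derivative (G : C -> C) (m0 A : C) : Prop :=
  forall k : R, 0 < k -> exists r : R, 0 < r /\ forall u v : C,
    Cmod (u - m0) <= r -> Cmod (v - m0) <= r ->
    Cmod (G u - G v - A * (u - v)) <= k * Cmod (u - v).

(** For real [lam] near [lam0] the simplified Newton map
    [u -> u - (G u - lam) / A] contracts a fixed disc around [m0] into itself;
    its fixed point is [mu lam]. The same estimate bounds [|u - v|] by
    [2 |G u - G v| / |A|], whence continuity. The sign of the real part comes
    from [A (mu lam - m0) = lam - lam0 + o(lam - lam0)]: multiplying by the
    conjugate of [A], the leading term is [Re A (lam - lam0)]. *)
Lemma real_preimage_curve (G : C -> C) (m0 A : C) (lam0 : R) :
  strict_C_derivative G m0 A -> 0 < Re A -> G m0 = RtoC lam0 ->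
  exists (mu : R -> C) (delta : R), 0 < delta /\ mu lam0 = m0 /\
    forall lam : R, Rabs (lam - lam0) < delta ->
      G (mu lam) = RtoC lam /\ continuous mu lam /\
      (lam <> lam0 -> 0 < Re (mu lam - m0) * (lam - lam0)).
Proof.
  intros HG HA HG0.
  assert (HA0 : 0 < Cmod A).
  { pose proof (re_le_Cmod A). pose proof (Rle_abs (Re A)). lra. }
  assert (HAn : A <> RtoC 0) by now apply Cmod_gt_0.
  (* Re A / 4 is at most |A| / 2, enough for the contraction, and small enough
     for the error term to cost only half of the crossing speed. *)
  destruct (HG (Re A / 4)) as [r [Hr Hstrict]]; [lra|].
  assert (HRe : Re A <= Cmod A).
  { pose proof (re_le_Cmod A). pose proof (Rle_abs (Re A)). lra. }
  pose (N := fun (lam : R) (u : C) => (u - (G u - RtoC lam) / A)%C).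
  exists (fun lam => iteration_limit (N lam) m0), (Cmod A * r / 2).
  assert (Hinit : Cmod (m0 - m0) = 0).
  { replace (m0 - m0)%C with (RtoC 0) by ring. apply Cmod_0. }
  assert (Hfix : forall lam, Rabs (lam - lam0) < Cmod A * r / 2 ->
    Cmod (iteration_limit (N lam) m0 - m0) <= r /\ G (iteration_limit (N lam) m0) = RtoC lam).
  { intros lam Hlam.
    assert (Hcontr : forall u v, Cmod (u - m0) <= r -> Cmod (v - m0) <= r ->
      Cmod (N lam u - N lam v) <= / 2 * Cmod (u - v)).
    { intros u v Hu Hv. unfold N.
      replace (u - (G u - RtoC lam) / A - (v - (G v - RtoC lam) / A))%C
        with (- ((G u - G v - A * (u - v)) / A))%C by now field.
      rewrite Cmod_opp, Cmod_div by exact HAn. apply Rle_div_l; [lra|].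
      pose proof (Cmod_ge_0 (u - v)). specialize (Hstrict u v Hu Hv). nra. }
    destruct (contraction_fixed_point (N lam) m0 r Hr) as [Hb Hf].
    - intros u Hu.
      assert (Hm : Cmod (m0 - m0) <= r) by lra.
      specialize (Hcontr u m0 Hu Hm).
      assert (H0 : Cmod (N lam m0 - m0) <= r / 2).
      { unfold N. rewrite HG0.
        replace (m0 - (RtoC lam0 - RtoC lam) / A - m0)%C with (RtoC (lam - lam0) / A)%C
          by (rewrite RtoC_minus; now field).
        rewrite Cmod_div, Cmod_R by exact HAn. apply Rle_div_l; lra. }
      pose proof (Cmod_triangle_minus (N lam u) (N lam m0) m0). lra.
    - exact Hcontr.
    - split; [exact Hb|]. set (L := iteration_limit (N lam) m0) in *.
      replace (G L) with (RtoC lam + A * (L - N lam L))%C by (unfold N; now field).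
      rewrite Hf. ring. }
  assert (Hlip : forall u v, Cmod (u - m0) <= r -> Cmod (v - m0) <= r ->
    Cmod A * Cmod (u - v) <= 2 * Cmod (G u - G v)).
  { intros u v Hu Hv. specialize (Hstrict u v Hu Hv).
    pose proof (Cmod_triangle (G u - G v) (- (G u - G v - A * (u - v)))) as H.
    rewrite Cmod_opp in H.
    replace (G u - G v + - (G u - G v - A * (u - v)))%C with (A * (u - v))%C in H by ring.
    rewrite Cmod_mult in H. pose proof (Cmod_ge_0 (u - v)). nra. }
  assert (Hpos : 0 < Cmod A * r / 2) by nra.
  split; [exact Hpos|]. split.
  - destruct (Hfix lam0) as [Hb Hf].
    { rewrite Rminus_diag, Rabs_R0. exact Hpos. }
    apply Ceq_minus, Cmod_eq_0.
    pose proof (Hlip _ m0 Hb ltac:(lra)) as H.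
    rewrite Hf, HG0 in H. replace (RtoC lam0 - RtoC lam0)%C with (RtoC 0) in H by ring.
    rewrite Cmod_0 in H. pose proof (Cmod_ge_0 (iteration_limit (N lam0) m0 - m0)). nra.
  - intros lam Hlam. destruct (Hfix lam Hlam) as [Hb Hf]. split; [exact Hf|]. split.
    + apply (filterlim_locally (U := C_UniformSpace)). intros eps.
      assert (Hrad : 0 < Rmin (Cmod A * r / 2 - Rabs (lam - lam0)) (Cmod A * eps / 4)).
      { pose proof (cond_pos eps). apply Rmin_pos; nra. }
      exists (mkposreal _ Hrad). intros lam' Hlam'.
      change (Rabs (lam' - lam) < Rmin (Cmod A * r / 2 - Rabs (lam - lam0)) (Cmod A * eps / 4)) in Hlam'.
      pose proof (Rmin_l (Cmod A * r / 2 - Rabs (lam - lam0)) (Cmod A * eps / 4)).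
      pose proof (Rmin_r (Cmod A * r / 2 - Rabs (lam - lam0)) (Cmod A * eps / 4)).
      destruct (Hfix lam') as [Hb' Hf'].
      { replace (lam' - lam0) with ((lam' - lam) + (lam - lam0)) by ring.
        pose proof (Rabs_triang (lam' - lam) (lam - lam0)). lra. }
      pose proof (Hlip _ _ Hb' Hb) as HL. rewrite Hf, Hf', <- RtoC_minus, Cmod_R in HL.
      apply (C_NormedModule_mixin_compat1 (iteration_limit (N lam) m0)).
      change (Cmod (iteration_limit (N lam') m0 - iteration_limit (N lam) m0) < eps).
      pose proof (cond_pos eps). nra.
    + intros Hne. set (u := iteration_limit (N lam) m0) in *.
      pose proof (Hlip u m0 Hb ltac:(lra)) as HL.
      specialize (Hstrict u m0 Hb ltac:(lra)).
      rewrite Hf, HG0, <- RtoC_minus in Hstrict, HL. rewrite Cmod_R in HL.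
      set (h := lam - lam0) in *. set (e := (RtoC h - A * (u - m0))%C) in *.
      assert (He : Rabs (Re (Cconj A * e)) <= Re A / 2 * Rabs h).
      { eapply Rle_trans; [apply re_le_Cmod|].
        rewrite Cmod_mult, Cmod_conj. nra. }
      assert (Hid : Cmod A ^ 2 * Re (u - m0) = Re A * h - Re (Cconj A * e)).
      { rewrite Cmod2_alt. unfold e, Cconj, Re, Im, RtoC.
        destruct A as [A1 A2], u as [u1 u2], m0 as [x y]. simpl. ring. }
      assert (Hh : h <> 0) by (unfold h; lra).
      assert (Hsq : Rabs (Re (Cconj A * e) * h) <= Re A / 2 * (h * h)).
      { rewrite Rabs_mult. rewrite <- (Rabs_pos_eq (h * h)) by nra. rewrite Rabs_mult.
        pose proof (Rabs_pos h). nra. }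
      pose proof (Rle_abs (Re (Cconj A * e) * h)).
      assert (0 < h * h) by nra.
      assert (0 < Cmod A ^ 2 * (Re (u - m0) * h)).
      { replace (Cmod A ^ 2 * (Re (u - m0) * h)) with (Cmod A ^ 2 * Re (u - m0) * h) by ring.
        rewrite Hid. nra. }
      assert (0 < Cmod A ^ 2) by nra.
      nra.
Qed.

(** * The characteristic root crosses the imaginary axis *)

Lemma Cexp_near_0 (k : R) : 0 < k -> exists r : R, 0 < r /\
  forall x : C, Cmod x <= r -> Cmod (Cexp x - 1 - x) <= k * Cmod x.
Proof.
  intros Hk.
  (* The real part below contributes k' (|a| + 3 |b|), the imaginary part
     5 k' |b|: a total of at most 9 k' |x|. *)
  assert (Hk' : exists k', 0 < k' /\ k' <= 1 /\ 9 * k' <= k).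
  { exists (Rmin 1 (k / 9)). pose proof (Rmin_l 1 (k / 9)). pose proof (Rmin_r 1 (k / 9)).
    split; [apply Rmin_pos; lra|lra]. }
  destruct Hk' as [k' [Hk0 [Hk1 Hk9]]].
  destruct (is_derive_slope exp 0 1 k') as [r1 [Hr1 H1]]; auto.
  { auto_derive; [easy|]. rewrite exp_0. ring. }
  destruct (is_derive_slope cos 0 0 k') as [r2 [Hr2 H2]]; auto.
  { auto_derive; [easy|]. rewrite sin_0. ring. }
  destruct (is_derive_slope sin 0 1 k') as [r3 [Hr3 H3]]; auto.
  { auto_derive; [easy|]. rewrite cos_0. ring. }
  assert (Hr : exists r, 0 < r /\ r < r1 /\ r < r2 /\ r < r3 /\ r <= k').
  { exists (Rmin (Rmin r1 r2) (Rmin r3 k') / 2).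
    pose proof (Rmin_l (Rmin r1 r2) (Rmin r3 k')). pose proof (Rmin_r (Rmin r1 r2) (Rmin r3 k')).
    pose proof (Rmin_l r1 r2). pose proof (Rmin_r r1 r2).
    pose proof (Rmin_l r3 k'). pose proof (Rmin_r r3 k').
    assert (0 < Rmin (Rmin r1 r2) (Rmin r3 k')) by (repeat apply Rmin_pos; auto).
    lra. }
  destruct Hr as [r [Hr [Ha [Hb [Hc Hd]]]]].
  exists r. split; [exact Hr|]. intros x Hx.
  pose proof (re_le_Cmod x) as HRe. pose proof (im_le_Cmod x) as HIm.
  destruct (H1 (Re x)) as [d1 [Hd1 E1]]; [rewrite Rminus_0_r; lra|].
  destruct (H2 (Im x)) as [d2 [Hd2 E2]]; [rewrite Rminus_0_r; lra|].
  destruct (H3 (Im x)) as [d3 [Hd3 E3]]; [rewrite Rminus_0_r; lra|].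
  rewrite exp_0 in E1. rewrite cos_0 in E2. rewrite sin_0 in E3.
  rewrite Rminus_0_r in E1, E2, E3.
  eapply Rle_trans; [apply Cmod_le_Rabs|].
  replace (Re (Cexp x - 1 - x)) with (exp (Re x) * cos (Im x) - 1 - Re x)
    by (unfold Cexp, Re, Im, RtoC; simpl; ring).
  replace (Im (Cexp x - 1 - x)) with (exp (Re x) * sin (Im x) - Im x)
    by (unfold Cexp, Re, Im, RtoC; simpl; ring).
  set (a := Re x) in *. set (b := Im x) in *.
  replace (exp a) with (1 + (1 + d1) * a) by lra.
  replace (cos b) with (1 + d2 * b) by lra.
  replace (sin b) with ((1 + d3) * b) by lra.
  replace ((1 + (1 + d1) * a) * (1 + d2 * b) - 1 - a)
    with (d1 * a + (1 + (1 + d1) * a) * d2 * b) by ring.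
  replace ((1 + (1 + d1) * a) * ((1 + d3) * b) - b)
    with ((d3 + (1 + d1) * (1 + d3) * a) * b) by ring.
  assert (Hab : forall d, Rabs d <= k' -> Rabs (1 + d) <= 2).
  { intros d Hd'. pose proof (Rabs_triang 1 d). rewrite Rabs_R1 in H. lra. }
  pose proof (Hab d1 Hd1) as B1. pose proof (Hab d3 Hd3) as B3.
  pose proof (Rabs_pos a). pose proof (Rabs_pos b). pose proof (Rabs_pos (1 + d1)).
  pose proof (Rabs_pos (1 + d3)). pose proof (Rabs_pos d2).
  assert (T1 : Rabs (d1 * a + (1 + (1 + d1) * a) * d2 * b) <= k' * Rabs a + 3 * k' * Rabs b).
  { eapply Rle_trans; [apply Rabs_triang|]. rewrite !Rabs_mult.
    assert (Rabs (1 + (1 + d1) * a) <= 3).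
    { eapply Rle_trans; [apply Rabs_triang|]. rewrite Rabs_R1, Rabs_mult. nra. }
    pose proof (Rabs_pos (1 + (1 + d1) * a)).
    assert (Rabs (1 + (1 + d1) * a) * Rabs d2 <= 3 * k') by (apply Rmult_le_compat; lra).
    nra. }
  assert (T2 : Rabs ((d3 + (1 + d1) * (1 + d3) * a) * b) <= 5 * k' * Rabs b).
  { rewrite Rabs_mult. apply Rmult_le_compat_r; [apply Rabs_pos|].
    eapply Rle_trans; [apply Rabs_triang|]. rewrite !Rabs_mult.
    assert (Rabs (1 + d1) * Rabs (1 + d3) <= 2 * 2) by (apply Rmult_le_compat; lra).
    nra. }
  nra.
Qed.

(** The functional equation moves the estimate from [0] to an arbitrary [w]:
    [e^u - e^v = e^w e^{v - w} (e^{u - v} - 1)]. *)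
Lemma strict_C_derivative_Cexp (w : C) : strict_C_derivative Cexp w (Cexp w).
Proof.
  intros k Hk.
  assert (HM : 0 < Cmod (Cexp w)) by (rewrite Cmod_Cexp; apply exp_pos).
  set (M := Cmod (Cexp w)) in *.
  assert (Hk' : exists k', 0 < k' /\ k' <= 1 /\ M * (4 * k') <= k).
  { exists (Rmin 1 (k / (4 * M))).
    pose proof (Rmin_l 1 (k / (4 * M))). pose proof (Rmin_r 1 (k / (4 * M))) as H0.
    assert (0 < k / (4 * M)) by (apply Rdiv_lt_0_compat; lra).
    split; [apply Rmin_pos; lra|]. split; [lra|].
    apply Rle_div_r in H0; lra. }
  destruct Hk' as [k' [Hk0 [Hk1 HkM]]].
  destruct (Cexp_near_0 k' Hk0) as [r1 [Hr1 H1]].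
  assert (Hr : exists r, 0 < r /\ 2 * r <= r1 /\ 2 * r <= k').
  { exists (Rmin r1 k' / 2). pose proof (Rmin_l r1 k'). pose proof (Rmin_r r1 k').
    assert (0 < Rmin r1 k') by now apply Rmin_pos. lra. }
  destruct Hr as [r [Hr [Hra Hrb]]].
  exists r. split; [exact Hr|]. intros u v Hu Hv.
  assert (Huv : Cmod (u - v) <= 2 * r).
  { pose proof (Cmod_triangle_minus u w v). rewrite (Cmod_minus_sym w v) in H. lra. }
  assert (Hone : forall x : C, Cmod x <= r1 -> Cmod (Cexp x - 1) <= 2 * Cmod x).
  { intros x Hx. replace (Cexp x - 1)%C with ((Cexp x - 1 - x) + x)%C by ring.
    eapply Rle_trans; [apply Cmod_triangle|].
    specialize (H1 x Hx). pose proof (Cmod_ge_0 x). nra. }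
  pose proof (Hone (v - w)%C ltac:(lra)) as H2.
  assert (H3 : Cmod (Cexp (v - w)) <= 2).
  { pose proof (Cmod_minus_le (Cexp (v - w)) 1). rewrite Cmod_1 in H. lra. }
  pose proof (H1 (u - v)%C ltac:(lra)) as H4.
  replace (Cexp u) with (Cexp w * (Cexp (v - w) * Cexp (u - v)))%C
    by (rewrite <- !Cexp_plus; f_equal; ring).
  replace (Cexp v) with (Cexp w * Cexp (v - w))%C
    by (rewrite <- !Cexp_plus; f_equal; ring).
  replace (Cexp w * (Cexp (v - w) * Cexp (u - v)) - Cexp w * Cexp (v - w) - Cexp w * (u - v))%C
    with (Cexp w * (Cexp (v - w) * (Cexp (u - v) - 1 - (u - v)) + (Cexp (v - w) - 1) * (u - v)))%C
    by ring.
  rewrite Cmod_mult. fold M.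
  assert (H5 : Cmod (Cexp (v - w) * (Cexp (u - v) - 1 - (u - v)) + (Cexp (v - w) - 1) * (u - v))
    <= 4 * k' * Cmod (u - v)).
  { eapply Rle_trans; [apply Cmod_triangle|]. rewrite !Cmod_mult.
    pose proof (Cmod_ge_0 (u - v)). pose proof (Cmod_ge_0 (Cexp (v - w))).
    pose proof (Cmod_ge_0 (Cexp (u - v) - 1 - (u - v))). nra. }
  pose proof (Cmod_ge_0 (u - v)). nra.
Qed.

Lemma char_fun_lam (K beta tau lam : R) (mu : C) :
  char_fun K beta tau lam mu = (char_fun K beta tau 0 mu - RtoC lam)%C.
Proof. unfold char_fun. ring. Qed.

(** The derivative of [char_fun] with respect to [mu]. *)
Definition char_slope (K beta tau : R) (mu : C) : C :=
  (1 + RtoC K * Cexp (Ci * RtoC beta) * (RtoC tau * Cexp (- (mu * RtoC tau))))%C.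

Lemma strict_C_derivative_char_fun (K beta tau lam : R) (m0 : C) :
  strict_C_derivative (char_fun K beta tau lam) m0 (char_slope K beta tau m0).
Proof.
  intros k Hk.
  pose proof (Rabs_pos K) as HK. pose proof (Rabs_pos tau) as Ht.
  assert (Hp : 0 <= Rabs K * Rabs tau) by nra.
  set (q := Rabs K * Rabs tau) in *.
  assert (Hk2 : 0 < k / (q + 1)) by (apply Rdiv_lt_0_compat; lra).
  destruct (strict_C_derivative_Cexp (- (m0 * RtoC tau)) _ Hk2) as [r [Hr H]].
  assert (Hr2 : 0 < r / (Rabs tau + 1)) by (apply Rdiv_lt_0_compat; lra).
  exists (r / (Rabs tau + 1)). split; [exact Hr2|].
  assert (Hscale : forall u v : C,
    Cmod (- (u * RtoC tau) - - (v * RtoC tau)) = Rabs tau * Cmod (u - v)).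
  { intros u v. replace (- (u * RtoC tau) - - (v * RtoC tau))%C with (- (RtoC tau * (u - v)))%C by ring.
    now rewrite Cmod_opp, Cmod_mult, Cmod_R. }
  assert (Hin : forall u : C, Cmod (u - m0) <= r / (Rabs tau + 1) ->
    Cmod (- (u * RtoC tau) - - (m0 * RtoC tau)) <= r).
  { intros u Hu. rewrite Hscale. apply Rle_div_r in Hu; [|lra].
    pose proof (Cmod_ge_0 (u - m0)). nra. }
  intros u v Hu Hv. specialize (H _ _ (Hin u Hu) (Hin v Hv)). rewrite Hscale in H.
  set (d := (Cexp (- (u * RtoC tau)) - Cexp (- (v * RtoC tau)) -
       Cexp (- (m0 * RtoC tau)) * (- (u * RtoC tau) - - (v * RtoC tau)))%C) in *.
  replace (char_fun K beta tau lam u - char_fun K beta tau lam v - char_slope K beta tau m0 * (u - v))%C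
    with (- (RtoC K * Cexp (Ci * RtoC beta) * d))%C
    by (unfold char_fun, char_slope, d; ring).
  rewrite Cmod_opp, !Cmod_mult, Cmod_R, Cmod_Cexp_Ci, Rmult_1_r.
  apply (Rle_trans _ (Rabs K * (k / (q + 1) * (Rabs tau * Cmod (u - v))))).
  { apply Rmult_le_compat_l; assumption. }
  replace (Rabs K * (k / (q + 1) * (Rabs tau * Cmod (u - v))))
    with (k * Cmod (u - v) * (q / (q + 1))) by (unfold q; field; fold q; lra).
  assert (q / (q + 1) <= 1) by (apply Rle_div_l; lra).
  rewrite <- (Rmult_1_r (k * Cmod (u - v))) at 2.
  apply Rmult_le_compat_l; [|assumption].
  pose proof (Cmod_ge_0 (u - v)). nra.
Qed.

Lemma critical_root_crossing (K beta tau lam0 w0 : R) :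
  char_fun K beta tau lam0 (Ci * RtoC w0) = RtoC 0 ->
  0 < Re (char_slope K beta tau (Ci * RtoC w0)) ->
  exists mu : R -> C, critical_root K beta tau lam0 w0 mu /\
    exists delta : R, 0 < delta /\ forall lam : R, Rabs (lam - lam0) < delta ->
      lam <> lam0 -> 0 < Re (mu lam) * (lam - lam0).
Proof.
  intros H0 HA.
  destruct (real_preimage_curve (char_fun K beta tau 0) (Ci * RtoC w0)
              (char_slope K beta tau (Ci * RtoC w0)) lam0) as [mu [delta [Hd [Hmu0 Hmu]]]]; auto.
  { apply strict_C_derivative_char_fun. }
  { rewrite char_fun_lam in H0. now apply Ceq_minus in H0. }
  exists mu. split.
  - split; [exact Hmu0|]. exists delta. split; [exact Hd|].
    intros lam Hlam. destruct (Hmu lam Hlam) as [HG [Hc _]]. split; [|exact Hc].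
    rewrite char_fun_lam, HG. ring.
  - exists delta. split; [exact Hd|].
    intros lam Hlam Hne. destruct (Hmu lam Hlam) as [_ [_ Hs]].
    specialize (Hs Hne).
    replace (Re (mu lam)) with (Re (mu lam - Ci * RtoC w0)); [exact Hs|].
    unfold Ci, RtoC, Re; simpl. ring.
Qed.

(** * Rotating waves *)

(** On the imaginary axis the characteristic function has the components
    [wave_lam - lam] and [wave_detuning], see [char_fun_Ci]; so [wave_lam om] is
    the value of [lam] that a root [i om] would force. *)
Definition wave_lam (K beta tau om : R) : R :=
  K * (cos beta - cos (beta - om * tau)).

Definition wave_detuning (K beta tau om : R) : R :=
  om - 1 + K * (sin beta - sin (beta - om * tau)).

Lemma char_fun_Ci (K beta tau lam om : R) :
  char_fun K beta tau lam (Ci * RtoC om) =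
    (wave_lam K beta tau om - lam, wave_detuning K beta tau om).
Proof.
  unfold char_fun, wave_lam, wave_detuning.
  replace (RtoC K * Cexp (Ci * RtoC beta) * (RtoC 1 - Cexp (- (Ci * RtoC om * RtoC tau))))%C
    with (RtoC K * (Cexp (Ci * RtoC beta) - Cexp (Ci * RtoC (beta - om * tau))))%C.
  - rewrite !Cexp_Ci. unfold Ci, RtoC. apply injective_projections; simpl; ring.
  - rewrite RtoC_minus, RtoC_mult.
    replace (Ci * (RtoC beta - RtoC om * RtoC tau))%C
      with (Ci * RtoC beta + - (Ci * RtoC om * RtoC tau))%C by ring.
    rewrite Cexp_plus. ring.
Qed.

Lemma char_slope_Ci (K beta tau om : R) :
  Re (char_slope K beta tau (Ci * RtoC om)) = 1 + K * tau * cos (beta - om * tau).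
Proof.
  unfold char_slope.
  replace (RtoC K * Cexp (Ci * RtoC beta) * (RtoC tau * Cexp (- (Ci * RtoC om * RtoC tau))))%C
    with (RtoC (K * tau) * Cexp (Ci * RtoC (beta - om * tau)))%C.
  - rewrite Cexp_Ci. unfold Re; simpl. ring.
  - rewrite RtoC_minus, !RtoC_mult.
    replace (Ci * (RtoC beta - RtoC om * RtoC tau))%C
      with (Ci * RtoC beta + - (Ci * RtoC om * RtoC tau))%C by ring.
    rewrite Cexp_plus. ring.
Qed.

Lemma is_derive_wave_lam (K beta tau om : R) :
  is_derive (wave_lam K beta tau) om (- (K * tau * sin (beta - om * tau))).
Proof. unfold wave_lam. auto_derive; [easy|]. unfold Rminus. ring. Qed.

Lemma is_derive_wave_detuning (K beta tau om : R) :
  is_derive (wave_detuning K beta tau) om (1 + K * tau * cos (beta - om * tau)).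
Proof. unfold wave_detuning. auto_derive; [easy|]. unfold Rminus. ring. Qed.

(** On a rotating wave [|z|] is constant and the delay is multiplication by
    [e^{- i om tau}], so the equation reduces to
    [char_fun (i om) = (1 + i gamma) r^2], whose real and imaginary parts are the
    two hypotheses. *)
Lemma dde_rotating_wave (K gamma beta tau lam om r : R) :
  wave_lam K beta tau om - lam = r ^ 2 ->
  wave_detuning K beta tau om = gamma * r ^ 2 ->
  dde_solution K gamma beta tau lam (fun t => RtoC r * Cexp (Ci * RtoC (om * t)))%C.
Proof.
  intros Hl Hd t.
  pose proof (is_derive_Cmult _ _ t _ _
    (is_derive_const (V := C_R_NormedModule) (RtoC r) t) (is_derive_Cexp_Ci om t)) as H.
  refine (eq_rect _ (fun d => is_derive (V := C_R_NormedModule) _ t d) H _ _).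
  match goal with |- ?x = ?y => change (@eq C x y) end.
  change (zero : C_R_NormedModule) with (RtoC 0).
  rewrite Cmod_mult, Cmod_Cexp_Ci, Cmod_R, Rmult_1_r, pow2_abs.
  pose proof (char_fun_Ci K beta tau lam om) as HX.
  rewrite Hl, Hd in HX.
  replace (r ^ 2, gamma * r ^ 2) with ((RtoC 1 + Ci * RtoC gamma) * RtoC (r ^ 2))%C in HX
    by (unfold Ci, RtoC; apply injective_projections; simpl; ring).
  rewrite <- HX. unfold char_fun.
  replace (om * (t - tau)) with (om * t + - om * tau) by ring.
  rewrite Cexp_Ci_plus.
  replace (Ci * RtoC (- om * tau))%C with (- (Ci * RtoC om * RtoC tau))%C
    by (rewrite RtoC_mult, RtoC_opp; ring).
  ring.
Qed.

Lemma Cexp_full_turn (om : R) : om <> 0 ->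
  Cexp (Ci * RtoC (om * (2 * PI / Rabs om))) = RtoC 1.
Proof.
  intros Hom. rewrite Cexp_Ci. unfold RtoC.
  destruct (Rdichotomy _ _ Hom) as [Hn|Hp].
  - rewrite Rabs_left by exact Hn.
    replace (om * (2 * PI / - om)) with (- (2 * PI)) by (field; lra).
    now rewrite cos_neg, sin_neg, cos_2PI, sin_2PI, Ropp_0.
  - rewrite Rabs_pos_eq by lra.
    replace (om * (2 * PI / om)) with (2 * PI) by (field; lra).
    now rewrite cos_2PI, sin_2PI.
Qed.

Lemma Cexp_half_turn (om : R) : om <> 0 ->
  Cexp (Ci * RtoC (om * (PI / Rabs om))) = RtoC (- 1).
Proof.
  intros Hom. rewrite Cexp_Ci. unfold RtoC.
  destruct (Rdichotomy _ _ Hom) as [Hn|Hp].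
  - rewrite Rabs_left by exact Hn.
    replace (om * (PI / - om)) with (- PI) by (field; lra).
    now rewrite cos_neg, sin_neg, cos_PI, sin_PI, Ropp_0.
  - rewrite Rabs_pos_eq by lra.
    replace (om * (PI / om)) with PI by (field; lra).
    now rewrite cos_PI, sin_PI.
Qed.

Lemma periodic_rotating_wave (K gamma beta tau lam om r : R) :
  wave_lam K beta tau om - lam = r ^ 2 ->
  wave_detuning K beta tau om = gamma * r ^ 2 -> om <> 0 -> 0 < r ->
  periodic_solution K gamma beta tau lam (2 * PI / Rabs om)
    (fun t => RtoC r * Cexp (Ci * RtoC (om * t)))%C.
Proof.
  intros Hl Hd Hom Hr. split; [now apply dde_rotating_wave|].
  pose proof (Rabs_pos_lt _ Hom). pose proof PI_RGT_0.
  split; [apply Rdiv_lt_0_compat; lra|]. split.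
  - intros t. rewrite Rmult_plus_distr_l, Cexp_Ci_plus, Cexp_full_turn by exact Hom. ring.
  - exists (PI / Rabs om). rewrite Cexp_half_turn, Rmult_0_r, Cmult_0_r, Cexp_0 by exact Hom.
    rewrite <- !RtoC_mult. intros He. apply RtoC_inj in He. lra.
Qed.

(** Solves the imaginary part [f om = gamma q] of the balance of a rotating wave
    for the squared amplitude [q], with [om = x0 + gamma s]. If [gamma <> 0]
    then [q] is forced to be [f (x0 + gamma s) / gamma], which is approximately
    [D s] and so positive for either sign of [gamma]; if [gamma = 0] the
    frequency does not move, and [q = s] is a choice of scale. *)
Lemma wave_amplitude (f : R -> R) (x0 D gamma : R) :
  (forall x, continuous f x) -> is_derive f x0 D -> f x0 = 0 -> 0 < D ->
  exists (q : R -> R) (s0 c : R), 0 < s0 /\ 0 < c /\ forall s : R, 0 < s < s0 ->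
    0 < q s <= c * s /\ continuous q s /\ f (x0 + gamma * s) = gamma * q s.
Proof.
  intros Hc Hf H0 HD. destruct (Req_dec gamma 0) as [->|Hg].
  - exists (fun s => s), 1, 1. split; [lra|]. split; [lra|]. intros s Hs.
    split; [lra|]. split; [apply continuous_id|].
    now rewrite !Rmult_0_l, Rplus_0_r.
  - destruct (is_derive_slope f x0 D (D / 2) Hf) as [r [Hr H]]; [lra|].
    pose proof (Rabs_pos_lt _ Hg) as Hg'.
    exists (fun s => f (x0 + gamma * s) / gamma), (r / Rabs gamma), (2 * D).
    split; [now apply Rdiv_lt_0_compat|]. split; [lra|]. intros s [Hs Hs'].
    assert (Hin : Rabs (x0 + gamma * s - x0) < r).
    { replace (x0 + gamma * s - x0) with (gamma * s) by ring.
      rewrite Rabs_mult, (Rabs_pos_eq s) by lra.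
      apply Rlt_div_r in Hs'; lra. }
    destruct (H _ Hin) as [d [Hd E]]. apply Rabs_le_between in Hd.
    replace (f (x0 + gamma * s) / gamma) with ((D + d) * s)
      by (replace (f (x0 + gamma * s)) with (f (x0 + gamma * s) - f x0) by lra;
          rewrite E; now field).
    split; [nra|]. split.
    + apply (continuous_mult (K := R_AbsRing) (fun s => f (x0 + gamma * s)) (fun _ => / gamma));
        [|apply continuous_const].
      apply (continuous_comp (fun s => x0 + gamma * s) f); [|apply Hc].
      apply (ex_derive_continuous (V := R_NormedModule)). now auto_derive.
    + rewrite <- (Rminus_0_r (f _)), <- H0, E. ring.
Qed.

(** The branch consists of the waves [sqrt (q s) e^{i (w0 + gamma s) t}], with [q]
    from [wave_amplitude] and [lam] read off the real part of the balance of
    [dde_rotating_wave]. *)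
Lemma rotating_wave_branch (K gamma beta tau lam0 w0 : R) :
  wave_lam K beta tau w0 = lam0 -> wave_detuning K beta tau w0 = 0 -> w0 <> 0 ->
  0 < 1 + K * tau * cos (beta - w0 * tau) ->
  exists (eps0 : R) (lam T : R -> R) (z : R -> R -> C),
    bifurcating_branch K gamma beta tau lam0 w0 eps0 lam T z.
Proof.
  intros Hlam Hdet Hw0 HD.
  assert (Hdetc : forall x, continuous (wave_detuning K beta tau) x).
  { intros x. apply (ex_derive_continuous (V := R_NormedModule)).
    eexists. apply is_derive_wave_detuning. }
  destruct (wave_amplitude (wave_detuning K beta tau) w0 _ gamma Hdetc
              (is_derive_wave_detuning K beta tau w0) Hdet HD)
    as [q [s0 [c [Hs0 [Hc Hq]]]]].
  pose proof (Rabs_pos_lt _ Hw0) as Hw0'.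
  pose (om := fun s => w0 + gamma * s).
  assert (Homc : forall s, continuous om s).
  { intros s. unfold om. apply (ex_derive_continuous (V := R_NormedModule)). now auto_derive. }
  assert (Hom0 : om 0 = w0) by (unfold om; ring).
  (* s1 keeps om away from 0, where the period would blow up. *)
  destruct (continuous_delta om 0 (Rabs w0) (Homc 0) Hw0') as [s1 [Hs1 Hom1]].
  rewrite Hom0 in Hom1.
  assert (Homnz : forall s, Rabs (s - 0) < s1 -> om s <> 0).
  { intros s Hs E. specialize (Hom1 s Hs). rewrite E, Rminus_0_l, Rabs_Ropp in Hom1. lra. }
  pose (lam := fun s => wave_lam K beta tau (om s) - q s).
  pose (T := fun s => 2 * PI / Rabs (om s)).
  assert (HTc : forall s, om s <> 0 -> continuous T s).
  { intros s Hs. apply (continuous_mult (K := R_AbsRing) (fun _ => 2 * PI) (fun s => / Rabs (om s)));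
      [apply continuous_const|].
    apply (continuous_comp (fun s => Rabs (om s)) Rinv).
    - apply (continuous_comp om Rabs); [apply Homc|apply continuous_Rabs].
    - apply continuous_Rinv. now apply Rabs_no_R0. }
  assert (HLc : forall s, continuous (fun s => wave_lam K beta tau (om s)) s).
  { intros s. apply (continuous_comp om (wave_lam K beta tau)); [apply Homc|].
    apply (ex_derive_continuous (V := R_NormedModule)). eexists. apply is_derive_wave_lam. }
  assert (Hper : forall s, 0 < s < Rmin s0 s1 ->
    periodic_solution K gamma beta tau (lam s) (T s)
      (fun t => RtoC (sqrt (q s)) * Cexp (Ci * RtoC (om s * t)))%C).
  { intros s [Hs Hs'].
    pose proof (Rmin_l s0 s1). pose proof (Rmin_r s0 s1).
    destruct (Hq s) as [Hqs [_ Hqd]]; [lra|].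
    assert (Hsq : sqrt (q s) ^ 2 = q s) by (apply pow2_sqrt; lra).
    apply periodic_rotating_wave.
    - rewrite Hsq. unfold lam. ring.
    - now rewrite Hsq.
    - apply Homnz. rewrite Rminus_0_r, Rabs_pos_eq; lra.
    - apply sqrt_lt_R0. lra. }
  exists (Rmin s0 s1), lam, T,
    (fun s t => RtoC (sqrt (q s)) * Cexp (Ci * RtoC (om s * t)))%C.
  assert (Hmin : 0 < Rmin s0 s1) by now apply Rmin_pos.
  split; [exact Hmin|]. split.
  - intros s Hs. split; [now apply Hper|].
    pose proof (Rmin_l s0 s1). pose proof (Rmin_r s0 s1).
    destruct (Hq s) as [Hqs [Hqc _]]; [lra|].
    split; [|split].
    + apply (continuous_minus (V := R_NormedModule) (fun s => wave_lam K beta tau (om s)) q);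
        [apply HLc|exact Hqc].
    + apply HTc, Homnz. rewrite Rminus_0_r, Rabs_pos_eq; lra.
    + intros t.
      assert (Hfst : continuous (fun p : R * R => fst p) (s, t))
        by apply (continuous_fst (U := R_UniformSpace) (V := R_UniformSpace)).
      assert (Hsnd : continuous (fun p : R * R => snd p) (s, t))
        by apply (continuous_snd (U := R_UniformSpace) (V := R_UniformSpace)).
      apply (continuous_Cmult (fun p : R * R => RtoC (sqrt (q (fst p))))
               (fun p : R * R => Cexp (Ci * RtoC (om (fst p) * snd p)))).
      * apply continuous_RtoC.
        apply (continuous_comp (fun p : R * R => q (fst p)) sqrt).
        -- now apply (continuous_comp (fun p : R * R => fst p) q).
        -- apply continuous_sqrt.
      * apply continuous_Cexp_Ci.
        apply (continuous_mult (K := R_AbsRing) (fun p : R * R => om (fst p)) (fun p : R * R => snd p));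
          [|exact Hsnd].
        apply (continuous_comp (fun p : R * R => fst p) om); [exact Hfst|apply Homc].
  - intros eta Heta.
    pose proof PI_RGT_0 as HPI.
    assert (HT0 : 0 < 2 * PI / Rabs w0) by (apply Rdiv_lt_0_compat; lra).
    set (T0 := 2 * PI / Rabs w0) in *.
    assert (HTc0 : continuous T 0) by (apply HTc; now rewrite Hom0).
    assert (Heta1 : 0 < Rmin eta 1) by (apply Rmin_pos; lra).
    destruct (continuous_delta _ 0 (eta / 2) (HLc 0) ltac:(lra)) as [r1 [Hr1 H1]].
    destruct (continuous_delta T 0 (Rmin eta 1) HTc0 Heta1) as [r2 [Hr2 H2]].
    assert (Heta3 : 0 < eta / (T0 + 1)) by (apply Rdiv_lt_0_compat; lra).
    destruct (continuous_delta om 0 _ (Homc 0) Heta3) as [r3 [Hr3 H3]].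
    assert (HT00 : T 0 = T0) by (unfold T; now rewrite Hom0).
    rewrite HT00 in H2. rewrite Hom0 in H1, H3. rewrite Hlam in H1.
    assert (Heta4 : 0 < Rmin (eta / 2) (eta ^ 2) / c).
    { apply Rdiv_lt_0_compat; [|exact Hc]. apply Rmin_pos; nra. }
    assert (Hdelta : exists delta, 0 < delta <= Rmin s0 s1 /\
      delta <= r1 /\ delta <= r2 /\ delta <= r3 /\ delta <= Rmin (eta / 2) (eta ^ 2) / c).
    { exists (Rmin (Rmin (Rmin s0 s1) r1) (Rmin (Rmin r2 r3) (Rmin (eta / 2) (eta ^ 2) / c))).
      set (e := Rmin (eta / 2) (eta ^ 2) / c) in *. set (m := Rmin s0 s1) in *.
      pose proof (Rmin_l (Rmin m r1) (Rmin (Rmin r2 r3) e)).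
      pose proof (Rmin_r (Rmin m r1) (Rmin (Rmin r2 r3) e)).
      pose proof (Rmin_l m r1). pose proof (Rmin_r m r1).
      pose proof (Rmin_l (Rmin r2 r3) e). pose proof (Rmin_r (Rmin r2 r3) e).
      pose proof (Rmin_l r2 r3). pose proof (Rmin_r r2 r3).
      split; [split; [repeat apply Rmin_pos; assumption|lra]|lra]. }
    destruct Hdelta as [delta [Hd [Hd1 [Hd2 [Hd3 Hd4]]]]].
    exists delta. split; [exact Hd|]. intros s Hs.
    assert (Hs0' : Rabs (s - 0) = s) by (rewrite Rminus_0_r, Rabs_pos_eq; lra).
    specialize (H1 s ltac:(lra)). specialize (H2 s ltac:(lra)). specialize (H3 s ltac:(lra)).
    pose proof (Rmin_l s0 s1). pose proof (Rmin_l eta 1). pose proof (Rmin_r eta 1).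
    destruct (Hq s) as [Hqs _]; [lra|].
    (* q < eta / 2 keeps lam near lam0, q < eta^2 keeps the amplitude sqrt q
       below eta. *)
    assert (Hqsmall : q s < Rmin (eta / 2) (eta ^ 2)).
    { assert (Hcs : s < Rmin (eta / 2) (eta ^ 2) / c) by lra.
      apply (Rlt_div_r _ _ _ Hc) in Hcs. lra. }
    pose proof (Rmin_l (eta / 2) (eta ^ 2)). pose proof (Rmin_r (eta / 2) (eta ^ 2)).
    split; [apply Hper; lra|]. split; [|split].
    + unfold lam. replace (wave_lam K beta tau (om s) - q s - lam0)
        with ((wave_lam K beta tau (om s) - lam0) - q s) by ring.
      apply Rabs_lt_between in H1. apply Rabs_lt_between. lra.
    + fold T0. lra.
    + assert (Hpos : 0 < sqrt (q s)) by (apply sqrt_lt_R0; lra).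
      exists (RtoC (sqrt (q s))). split.
      { intros E. apply RtoC_inj in E. lra. }
      rewrite Cmod_R, Rabs_pos_eq by lra. split.
      { rewrite <- (sqrt_pow2 eta) by lra. apply sqrt_lt_1; lra. }
      intros t Ht.
      replace (RtoC (sqrt (q s)) * Cexp (Ci * RtoC (om s * t)) - RtoC (sqrt (q s)) * Cexp (Ci * RtoC (w0 * t)))%C
        with (RtoC (sqrt (q s)) * (Cexp (Ci * RtoC (om s * t)) - Cexp (Ci * RtoC (w0 * t))))%C by ring.
      rewrite Cmod_mult, Cmod_R, Rabs_pos_eq by lra.
      rewrite Rmult_comm. apply Rmult_le_compat_r; [lra|].
      eapply Rle_trans; [apply Cexp_Ci_lipschitz|].
      replace (om s * t - w0 * t) with ((om s - w0) * t) by ring.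
      rewrite Rabs_mult, (Rabs_pos_eq t) by lra.
      apply (Rlt_div_r _ _ (T0 + 1) ltac:(lra)) in H3.
      apply Rabs_lt_between in H2.
      pose proof (Rabs_pos (om s - w0)). nra.
Qed.

(** * The side on which periodic solutions lie *)

(** Eliminating [x] gives [(D + d) y = - rho B], where [B] tends to
    [D + S gamma] as the four errors [p], [q], [d], [s] tend to [0]. In the
    application [x] is the frequency shift, [y] the shift of [lam], [rho] the
    squared amplitude, [1 + p + i q] the factor [m] of [char_fun_periodic], and
    [d], [s] are the errors in the slopes [D] and [- S]. *)
Lemma lam_shift_sign (D S gamma : R) : 0 < D -> D + S * gamma <> 0 ->
  exists k : R, 0 < k /\ forall rho p q d s x y : R, 0 < rho ->
    Rabs p <= k -> Rabs q <= k -> Rabs d <= k -> Rabs s <= k ->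
    (D + d) * x = rho * (gamma + (gamma * p + q)) ->
    y = (- S + s) * x - rho * (1 + (p - gamma * q)) ->
    y * (D + S * gamma) < 0.
Proof.
  intros HD HL. set (L := D + S * gamma) in *.
  pose proof (Rabs_pos_lt _ HL) as HL'.
  pose (G := Rabs gamma + 1). pose proof (Rabs_pos gamma) as Hg. pose proof (Rabs_pos S) as HS.
  (* |B - L| is at most G (|S| + D) k from p and q, plus 2 G k each from d and s,
     which gives the constant M. *)
  assert (HM : 0 < G * (Rabs S + D + 4)) by (unfold G; nra).
  set (M := G * (Rabs S + D + 4)) in *.
  assert (Hk : exists k, 0 < k /\ k <= 1 /\ k <= D / 2 /\ k * M <= Rabs L / 2).
  { exists (Rmin (Rmin 1 (D / 2)) (Rabs L / 2 / M)).
    assert (0 < Rabs L / 2 / M) by (apply Rdiv_lt_0_compat; lra).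
    pose proof (Rmin_l (Rmin 1 (D / 2)) (Rabs L / 2 / M)).
    pose proof (Rmin_r (Rmin 1 (D / 2)) (Rabs L / 2 / M)) as Hr.
    pose proof (Rmin_l 1 (D / 2)). pose proof (Rmin_r 1 (D / 2)).
    apply (Rle_div_r _ _ _ HM) in Hr.
    split; [repeat apply Rmin_pos; lra|lra]. }
  destruct Hk as [k [Hk0 [Hk1 [HkD HkM]]]].
  exists k. split; [exact Hk0|].
  intros rho p q d s x y Hrho Hp Hq Hd Hs Hx Hy.
  assert (HDd : 0 < D + d) by (apply Rabs_le_between in Hd; lra).
  pose (B := (S - s) * (gamma + (gamma * p + q)) + (D + d) * (1 + (p - gamma * q))).
  assert (HB : (D + d) * y = - rho * B).
  { rewrite Hy. transitivity ((- S + s) * ((D + d) * x) - (D + d) * (rho * (1 + (p - gamma * q)))); [ring|].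
    rewrite Hx. unfold B. ring. }
  assert (HBL : Rabs (B - L) <= k * M).
  { replace (B - L) with
      (S * (gamma * p + q) + - s * (gamma + (gamma * p + q)) + D * (p - gamma * q)
       + d * (1 + (p - gamma * q))) by (unfold B, L; ring).
    assert (E1 : Rabs (gamma * p + q) <= k * G).
    { eapply Rle_trans; [apply Rabs_triang|]. rewrite Rabs_mult. unfold G. nra. }
    assert (E2 : Rabs (p - gamma * q) <= k * G).
    { unfold Rminus. eapply Rle_trans; [apply Rabs_triang|]. rewrite Rabs_Ropp, Rabs_mult. unfold G. nra. }
    assert (E3 : Rabs (gamma + (gamma * p + q)) <= 2 * G).
    { eapply Rle_trans; [apply Rabs_triang|]. unfold G in *. nra. }
    assert (E4 : Rabs (1 + (p - gamma * q)) <= 2 * G).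
    { eapply Rle_trans; [apply Rabs_triang|]. rewrite Rabs_R1. unfold G in *. nra. }
    assert (F1 : Rabs (S * (gamma * p + q)) <= Rabs S * (k * G))
      by (rewrite Rabs_mult; now apply Rmult_le_compat_l).
    assert (F2 : Rabs (- s * (gamma + (gamma * p + q))) <= k * (2 * G))
      by (rewrite Rabs_mult, Rabs_Ropp; apply Rmult_le_compat; auto using Rabs_pos).
    assert (F3 : Rabs (D * (p - gamma * q)) <= D * (k * G))
      by (rewrite Rabs_mult, (Rabs_pos_eq D) by lra; apply Rmult_le_compat_l; lra).
    assert (F4 : Rabs (d * (1 + (p - gamma * q))) <= k * (2 * G))
      by (rewrite Rabs_mult; apply Rmult_le_compat; auto using Rabs_pos).
    eapply Rle_trans; [apply Rabs_triang|].
    eapply Rle_trans; [apply Rplus_le_compat_r, Rabs_triang|].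
    eapply Rle_trans; [apply Rplus_le_compat_r, Rplus_le_compat_r, Rabs_triang|].
    unfold M. lra. }
  assert (HBpos : 0 < B * L).
  { assert (Rabs ((B - L) * L) <= Rabs L / 2 * Rabs L).
    { rewrite Rabs_mult. apply Rmult_le_compat_r; lra. }
    apply Rabs_le_between in H. 
    assert (Rabs L * Rabs L = L * L) by (rewrite <- Rabs_mult; apply Rabs_pos_eq; nra).
    nra. }
  assert ((D + d) * (y * L) < 0).
  { replace ((D + d) * (y * L)) with ((D + d) * y * L) by ring. rewrite HB. nra. }
  nra.
Qed.

(** [char_fun_periodic] applies at the frequency [2 pi / T] with the sign of
    [w0]. That frequency is near [w0] because [T] is near [2 pi / |w0|], so
    [is_derive_slope] turns the two components into the hypotheses of
    [lam_shift_sign]. *)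
Lemma near_bifurcation_lam_side (K gamma beta tau lam0 w0 : R) :
  wave_lam K beta tau w0 = lam0 -> wave_detuning K beta tau w0 = 0 -> w0 <> 0 ->
  0 < 1 + K * tau * cos (beta - w0 * tau) ->
  1 + K * tau * (cos (beta - w0 * tau) + gamma * sin (beta - w0 * tau)) <> 0 ->
  exists eta : R, 0 < eta /\ forall (lam T : R) (z : R -> C),
    near_bifurcation K gamma beta tau lam0 w0 eta lam T z ->
    (lam - lam0) *
      (1 + K * tau * (cos (beta - w0 * tau) + gamma * sin (beta - w0 * tau))) < 0.
Proof.
  intros Hlam Hdet Hw0 HD HL.
  set (D := 1 + K * tau * cos (beta - w0 * tau)) in *.
  set (S := K * tau * sin (beta - w0 * tau)).
  replace (1 + K * tau * (cos (beta - w0 * tau) + gamma * sin (beta - w0 * tau)))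
    with (D + S * gamma) in * by (unfold D, S; ring).
  destruct (lam_shift_sign D S gamma HD HL) as [k [Hk Hsign]].
  destruct (is_derive_slope _ _ _ k (is_derive_wave_lam K beta tau w0) Hk) as [r1 [Hr1 H1]].
  destruct (is_derive_slope _ _ _ k (is_derive_wave_detuning K beta tau w0) Hk) as [r2 [Hr2 H2]].
  fold S in H1. fold D in H2.
  pose proof (Rabs_pos_lt _ Hw0) as Hw0'. pose proof PI_RGT_0 as HPI.
  assert (HT0 : 0 < 2 * PI / Rabs w0) by (apply Rdiv_lt_0_compat; lra).
  set (T0 := 2 * PI / Rabs w0) in *.
  pose (freq := fun T => w0 * T0 / T).
  assert (Hfreqc : continuous freq T0).
  { apply (continuous_mult (K := R_AbsRing) (fun _ => w0 * T0) Rinv);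
      [apply continuous_const|apply continuous_Rinv; lra]. }
  destruct (continuous_delta freq T0 (Rmin r1 r2) Hfreqc) as [r3 [Hr3 H3]].
  { now apply Rmin_pos. }
  assert (Hf0 : freq T0 = w0) by (unfold freq; field; lra).
  rewrite Hf0 in H3.
  (* k / 16 compensates the loss of a factor 16 in char_fun_periodic. *)
  assert (Hk' : 0 < Rmin (/ 2) (k / 16)) by (apply Rmin_pos; lra).
  set (k' := Rmin (/ 2) (k / 16)) in *.
  assert (Hk'1 : k' <= / 2) by apply Rmin_l.
  assert (Hk'2 : k' <= k / 16) by apply Rmin_r.
  (* Passing from e^{i w0 t} to e^{i om t} on a period costs a relative error of
     |w0| |T - T0|, on top of the eta in the closeness assumption. *)
  assert (Heta : exists eta, 0 < eta /\ eta <= r3 /\ eta <= T0 / 2 /\ eta * (1 + Rabs w0) <= k').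
  { exists (Rmin (Rmin r3 (T0 / 2)) (k' / (1 + Rabs w0))).
    assert (0 < k' / (1 + Rabs w0)) by (apply Rdiv_lt_0_compat; lra).
    pose proof (Rmin_l (Rmin r3 (T0 / 2)) (k' / (1 + Rabs w0))).
    pose proof (Rmin_r (Rmin r3 (T0 / 2)) (k' / (1 + Rabs w0))) as Hr.
    pose proof (Rmin_l r3 (T0 / 2)). pose proof (Rmin_r r3 (T0 / 2)).
    apply (Rle_div_r _ _ _ (Rplus_lt_0_compat 1 _ Rlt_0_1 Hw0')) in Hr.
    split; [repeat apply Rmin_pos; lra|lra]. }
  destruct Heta as [eta [Heta [Heta3 [HetaT Hetak]]]].
  exists eta. split; [exact Heta|].
  intros lam T z [[Hz [HT [Hper _]]] [_ [HTn [a [Ha [_ Hclose]]]]]].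
  fold T0 in HTn.
  set (om := freq T).
  assert (Hturn : Cexp (Ci * RtoC (om * T)) = RtoC 1).
  { rewrite <- (Cexp_full_turn w0 Hw0). do 3 f_equal. unfold om, freq. fold T0. field. lra. }
  assert (Homt : forall t, 0 <= t <= T -> Rabs (w0 * t - om * t) <= eta * Rabs w0).
  { intros t Ht.
    replace (w0 * t - om * t) with (w0 * (T - T0) * (t / T)) by (unfold om, freq; field; lra).
    rewrite !Rabs_mult, (Rabs_pos_eq (t / T)) by (apply Rdiv_le_0_compat; lra).
    assert (t / T <= 1) by (apply Rle_div_l; lra).
    assert (0 <= t / T) by (apply Rdiv_le_0_compat; lra).
    pose proof (Rabs_pos (T - T0)).
    assert (Rabs w0 * Rabs (T - T0) <= Rabs w0 * eta) by (apply Rmult_le_compat_l; lra).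
    assert (0 <= Rabs w0 * Rabs (T - T0)) by (apply Rmult_le_pos; lra).
    apply (Rle_trans _ (Rabs w0 * Rabs (T - T0) * 1)); [now apply Rmult_le_compat_l|lra]. }
  destruct (char_fun_periodic K gamma beta tau lam T om k' z a Hz HT Hper Hturn Ha Hk'1)
    as [m [Hm Hchi]].
  { intros t Ht.
    eapply Rle_trans; [apply (Cmod_triangle_minus _ (a * Cexp (Ci * RtoC (w0 * t))))|].
    replace (a * Cexp (Ci * RtoC (w0 * t)) - a * Cexp (Ci * RtoC (om * t)))%C
      with (a * (Cexp (Ci * RtoC (w0 * t)) - Cexp (Ci * RtoC (om * t))))%C by ring.
    rewrite Cmod_mult.
    pose proof (Cexp_Ci_lipschitz (w0 * t) (om * t)) as HE.
    specialize (Hclose t Ht). specialize (Homt t Ht). pose proof (Cmod_ge_0 a).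
    assert (Cmod a * Cmod (Cexp (Ci * RtoC (w0 * t)) - Cexp (Ci * RtoC (om * t)))
      <= Cmod a * (eta * Rabs w0)) by (apply Rmult_le_compat_l; lra).
    nra. }
  rewrite char_fun_Ci in Hchi.
  pose proof (Rmin_l r1 r2). pose proof (Rmin_r r1 r2).
  specialize (H3 T ltac:(lra)). fold om in H3.
  destruct (H1 om ltac:(lra)) as [s [Hs Es]]. destruct (H2 om ltac:(lra)) as [d [Hd Ed]].
  set (p := Re (m - 1)). set (q := Im (m - 1)).
  assert (Hp : Rabs p <= k) by (pose proof (re_le_Cmod (m - 1)); unfold p; lra).
  assert (Hq : Rabs q <= k) by (pose proof (im_le_Cmod (m - 1)); unfold q; lra).
  assert (Ha2 : 0 < Cmod a ^ 2).
  { apply pow_lt. now apply Cmod_gt_0. }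
  apply (Hsign (Cmod a ^ 2) p q d s (om - w0) (lam - lam0)); auto.
  - rewrite <- Ed, Hdet, Rminus_0_r.
    apply (f_equal Im) in Hchi. unfold Im at 1 in Hchi. simpl in Hchi. rewrite Hchi.
    unfold p, q, Ci, Re, Im, RtoC. simpl. ring.
  - rewrite <- Es, Hlam.
    apply (f_equal Re) in Hchi. unfold Re at 1 in Hchi. cbn [fst] in Hchi.
    replace (lam - lam0) with (wave_lam K beta tau om - lam0 - (wave_lam K beta tau om - lam)) by ring.
    rewrite Hchi. unfold p, q, Ci, Re, Im, RtoC. simpl. ring.
Qed.

(** * The direction of the bifurcation *)

Theorem corollary4p3 (K gamma beta lam tau phi : R)
  (hbeta : 0 <= beta <= PI)
  (hnz : (lam, tau) <> (0, 0))
  (htau : 0 <= tau)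
  (hphi : phi <> 0)
  (hden : 1 - K * (sin beta - sin (beta - phi)) <> 0)
  (hlam : lam = K * (cos beta - cos (beta - phi)))
  (htauE : tau = phi / (1 - K * (sin beta - sin (beta - phi))))
  (hsimple :
    (RtoC 1 + RtoC (K * tau) * Cexp (Ci * RtoC (beta - phi)))%C <> RtoC 0)
  (hcross : 0 < 1 + K * tau * cos (beta - phi)) :
  (0 < 1 + K * tau * (cos (beta - phi) + gamma * sin (beta - phi)) ->
   subcritical_hopf K gamma beta tau lam (phi / tau)) /\
  (1 + K * tau * (cos (beta - phi) + gamma * sin (beta - phi)) < 0 ->
   supercritical_hopf K gamma beta tau lam (phi / tau)).
Proof.
  set (w0 := phi / tau).
  assert (Htau : tau <> 0).
  { rewrite htauE. unfold Rdiv. apply Rmult_integral_contrapositive_currified; [exact hphi|].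
    now apply Rinv_neq_0_compat. }
  assert (Hw0tau : w0 * tau = phi) by (unfold w0; now field).
  assert (Hw0 : w0 <> 0) by (intros E; apply hphi; rewrite <- Hw0tau, E; ring).
  assert (Hw0E : w0 = 1 - K * (sin beta - sin (beta - phi))).
  { unfold w0. rewrite htauE. field. now split. }
  assert (Hlam : wave_lam K beta tau w0 = lam) by (unfold wave_lam; now rewrite Hw0tau).
  assert (Hdet : wave_detuning K beta tau w0 = 0).
  { unfold wave_detuning. rewrite Hw0tau, Hw0E. ring. }
  rewrite <- Hw0tau in hcross |- *.
  pose proof (rotating_wave_branch K gamma beta tau lam w0 Hlam Hdet Hw0 hcross) as Hbranch.
  destruct (critical_root_crossing K beta tau lam w0) as [mu [Hmu [delta [Hdelta Hcross]]]].
  { rewrite char_fun_Ci, Hlam, Hdet. unfold RtoC. now rewrite Rminus_diag. }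
  { now rewrite char_slope_Ci. }
  set (L := 1 + K * tau * (cos (beta - w0 * tau) + gamma * sin (beta - w0 * tau))).
  assert (Hside : L <> 0 -> exists eta, 0 < eta /\ forall (l T : R) (z : R -> C),
    near_bifurcation K gamma beta tau lam w0 eta l T z ->
    (l - lam) * L < 0 /\ 0 < Re (mu l) * (l - lam)).
  { intros HL.
    destruct (near_bifurcation_lam_side K gamma beta tau lam w0 Hlam Hdet Hw0 hcross HL)
      as [eta [Heta H]].
    exists (Rmin eta delta). split; [now apply Rmin_pos|].
    intros l T z [Hz [Hl [HT [a [Ha [Hsmall Hclose]]]]]].
    pose proof (Rmin_l eta delta). pose proof (Rmin_r eta delta).
    assert (Hs : (l - lam) * L < 0).
    { apply (H l T z). split; [exact Hz|]. split; [lra|]. split; [lra|].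
      exists a. split; [exact Ha|]. split; [lra|].
      intros t Ht. eapply Rle_trans; [now apply Hclose|].
      apply Rmult_le_compat_r; [apply Cmod_ge_0|assumption]. }
    split; [exact Hs|]. apply Hcross; [lra|].
    intros ->. rewrite Rminus_diag, Rmult_0_l in Hs. lra. }
  split; intros HL.
  - destruct Hside as [eta [Heta H]]; [lra|].
    split; [exact Hbranch|]. exists mu. split; [exact Hmu|].
    exists eta. split; [exact Heta|]. intros l T z Hnear.
    destruct (H l T z Hnear) as [Hs Hr]. nra.
  - destruct Hside as [eta [Heta H]]; [lra|].
    split; [exact Hbranch|]. exists mu. split; [exact Hmu|].
    exists eta. split; [exact Heta|]. intros l T z Hnear.
    destruct (H l T z Hnear) as [Hs Hr]. nra.
Qed.
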